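(* Let $G$ be a finite simple connected graph with a weight function $w:E(G)\to\mathbb{R}_{>0}$. Then $(G,w)$ is weighted stable (i.e. a weighted distance-hereditary graph) if and only if $(G,w)$ has width $1$.
   Context: For a finite simple connected graph $G=(V,E)$ with vertex variables $x_v$ ($v\in V$), let $S(G)$ be the set of spanning trees of $G$, and for a weight function $w:E\to\mathbb{R}$ define the weighted vertex spanning tree polynomial $P_{G,w}(x_1,\dots,x_n)=\sum_{T\in S(G)}\prod_{e\in T}w(e)\prod_{v\in V}x_v^{\deg_T(v)-1}$. A real polynomial is real stable if it does not vanish when all variables are taken in the open upper half-plane $\{z\in\mathbb{C}:\operatorname{Im} z>0\}$. The weighted graph $(G,w)$ is called weighted stable if $P_{G,w}$ is real stable, and weighted distance-hereditary graphs are defined to be the weighted stable graphs. Let $M_G$ be the weighted adjacency matrix of $(G,w)$ (entry $w(uv)$ for edges $uv$, $0$ otherwise). For $A\subseteq V$, the cut rank of $A$ is the rank of the submatrix of $M_G$ with columns indexed by $A$ and rows indexed by $V\setminus A$. For a tree $T$ whose leaves are exactly the vertices of $G$ and all of whose other vertices have degree $3$, each edge $e$ of $T$ splits the leaves into the two sides $A(e),B(e)$ of $T\setminus e$; the width of $e$ is the cut rank of $A(e)$ (equal to that of $B(e)$). The width of $(G,w)$ is the minimum over all such trees $T$ of the maximum width of an edge of $T$. *)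

(* Defs.v *)
From HB Require Import structures.
From mathcomp Require Import all_boot all_order all_algebra.
From mathcomp Require Import boolp reals.
From mathcomp Require Import complex.
From mathcomp Require Import mpoly.

Set Implicit Arguments.
Unset Strict Implicit.
Unset Printing Implicit Defensive.

Import Order.TTheory GRing.Theory Num.Theory.

Local Open Scope ring_scope.

(* A graph with vertex type V is given by its edge set E : {set {set V}};   *)
(* it is simple when every edge is a set of exactly two vertices.           *)
Section Graphs.
Variable V : finType.
Implicit Types E F : {set {set V}}.

Definition simple_graph E : Prop := forall e, e \in E -> #|e| = 2%N.

Definition adj E : rel V := [rel u v | [set u; v] \in E].

Definition deg E (v : V) : nat := #|[set e in E | v \in e]|.

Definition connected_graph E : Prop := forall u v : V, connect (adj E) u v.

Definition acyclic_graph E : Prop :=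
  forall c : seq V, (2 < size c)%N -> uniq c -> ~ cycle (adj E) c.

Definition is_tree E : Prop :=
  [/\ simple_graph E, connected_graph E & acyclic_graph E].

Definition spanning_trees E : {set {set {set V}}} :=
  [set F : {set {set V}} | (F \subset E) && `[< is_tree F >]].

End Graphs.

Section Stability.
Variable R : realType.

Definition real_stable (n : nat) (p : {mpoly R[n]}) : Prop :=
  forall z : 'I_n -> R[i],
    (forall i, 0 < complex.Im (z i)) -> (map_mpoly (real_complex R) p).@[z] != 0.

Variable V : finType.
Implicit Types (E : {set {set V}}) (w : {set V} -> R).

(* The variable x_v is 'X_(enum_rank v).  The natural-number predecessor    *)
(* deg - 1 is the true one as soon as #|V| >= 2, since then every vertex of *)
(* a spanning tree has positive degree.  Here and below only the values of  *)
(* w on E matter.                                                           *)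
Definition vertex_spanning_poly E w : {mpoly R[#|V|]} :=
  \sum_(F in spanning_trees E)
    (\prod_(e in F) w e) *: \prod_(v : V) 'X_(enum_rank v) ^+ (deg F v).-1.

Definition weighted_stable E w : Prop :=
  real_stable (vertex_spanning_poly E w).

End Stability.

Section Width.
Variable R : realType.
Variable V : finType.
Implicit Types (E : {set {set V}}) (w : {set V} -> R).

Definition weighted_adjmx E w : 'M[R]_#|V| :=
  \matrix_(i, j) let e := [set enum_val i; enum_val j] in
                 if e \in E then w e else 0.

Definition cut_rank E w (A : {set V}) : nat :=
  \rank (mxsub (fun i : 'I_#|~: A| => enum_rank (enum_val i))
               (fun j : 'I_#|A| => enum_rank (enum_val j))
               (weighted_adjmx E w)).

(* A tree whose leaves are identified with the vertices of the graph by the *)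
(* injection [leaf], all other nodes having degree 3.                       *)
Record leaf_tree := LeafTree {
  node : finType;
  tree_edges : {set {set node}};
  leaf : V -> node;
  tree_edgesP : is_tree tree_edges;
  leaf_inj : injective leaf;
  leafP : forall x : node, deg tree_edges x = 1%N <-> exists v, x = leaf v;
  innerP : forall x : node, deg tree_edges x <> 1%N -> deg tree_edges x = 3%N
}.

(* The graph vertices lying, in T minus the edge e, in the component of a.  *)
Definition side (T : leaf_tree) (e : {set node T}) (a : node T) : {set V} :=
  [set v | connect (adj (tree_edges T :\ e)) a (leaf T v)].

(* The maximum ranges over the two ends of e, hence over the two sides; their *)
(* cut ranks coincide, the two submatrices being transposes of each other.    *)
Definition edge_width E w (T : leaf_tree) (e : {set node T}) : nat :=
  \max_(a in e) cut_rank E w (side e a).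

Definition tree_width E w (T : leaf_tree) : nat :=
  \max_(e in tree_edges T) edge_width E w e.

(* k is the minimum of [tree_width E w T] over all T. *)
Definition has_width E w (k : nat) : Prop :=
  (exists T : leaf_tree, tree_width E w T = k) /\
  (forall T : leaf_tree, (k <= tree_width E w T)%N).

End Width.

(* Main.v *)
Require Import Defs.
From mathcomp Require Import all_boot all_order all_fingroup all_algebra.
From mathcomp Require Import boolp reals complex mpoly.
From mathcomp Require Import ring lra zify.

(**
By the matrix-tree theorem the polynomial vanishes at [x] in the open upper half-plane iff the equations
[sum_j w_ij x_j (z_j - z_i) = 0] (all [i]) have a nonconstant solution [z]. So stability says that for all such [x]
only constants solve them ([rigid]).

Width 1 implies stability. For every set [U] of at least three vertices some side of the tree meets [U] in exactly
two vertices [u], [v]; rank one makes their rows proportional on the rest of [U], which forces [z_u = z_v], and [u]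
is absorbed into [v] by replacing [x_v] with [x_v + c x_u].

Stability implies width 1. For large [t] the resolvent [N = (t - M)^-1] has positive entries, and its off-diagonal
blocks have rank one only where those of [M] do. If [(x, z)] solves the equations for [N], then [(N x, z)] solves
them for [M], so [N] is rigid as well, and by a Hurwitz argument so are its restrictions to subsets. For four
vertices this forces two of [N_12 N_34], [N_13 N_24], [N_14 N_23] to agree, and a positive weight on a complete
graph with this property always has a pair of twins (proportional rows). Splitting off twins one at a time builds
the tree.
*)

Set Implicit Arguments.
Unset Strict Implicit.
Unset Printing Implicit Defensive.

Import Order.TTheory GRing.Theory Num.Theory.

Local Open Scope ring_scope.

(** * Rooted functions and spanning trees *)

(** The detour through the resolvent is forced by the zero entries of [M]. On an unweighted
    five-cycle any four vertices induce a path, so two of the three products vanish and the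
    four-point condition holds for [M] itself, yet no two vertices are twins. With positive entries
    every vertex set is connected, and conditions on four vertices suffice. Linear equations permit
    the change of matrix: [z] is kept, and positivity of [N] keeps [N x] in the upper half-plane.
    The four-point condition comes from a quadratic form: for four vertices the polynomial is
    positive at the all-ones vector, and a second positive direction orthogonal to it yields a zero
    whose imaginary part is a multiple of that vector. Trees occur twice, as spanning trees and as
    decomposition trees. Both are handled as parent functions, maps whose iterates all reach a
    root. *)

Section RootedFunctions.
Variables (V : finType) (r : V).
Implicit Types (f g : V -> V) (F : {set {set V}}).

(** Encodes a tree on [V] oriented towards [r]. Fixing the root makes the parent function of an
    oriented tree unique, so that trees can be enumerated by functions. *)
Definition rooted f : bool := (f r == r) && [forall i, fconnect f i r].

Definition parent_edges f : {set {set V}} := [set [set i; f i] | i in predC1 r].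

(** The height is the number of steps to [r]. Most arguments along [f] below are inductions on it;
    conversely, any decreasing function certifies rootedness. *)
Lemma rooted_height f :
  rooted f -> exists h : V -> nat, forall i, i != r -> (h (f i) < h i)%N.
Proof.
case/andP=> _ /forallP reach.
have P i : exists k, iter k f i == r.
  by have /iter_findex fk := reach i; exists (findex f i r); apply/eqP.
exists (fun i => ex_minn (P i)) => i ir.
case: (ex_minnP (P i)) => -[|k] /eqP ki kmin.
  by rewrite /= in ki; rewrite ki eqxx in ir.
case: (ex_minnP (P (f i))) => m _; apply.
by rewrite -iterSr ki.
Qed.

Lemma height_rooted f (h : V -> nat) :
  f r = r -> (forall i, i != r -> (h (f i) < h i)%N) -> rooted f.
Proof.
move=> fr hf; rewrite /rooted fr eqxx; apply/forallP => i.
have [n] := ubnP (h i); elim: n i => // n IH i hi.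
have [->|ir] := eqVneq i r; first exact: connect0.
apply: connect_trans (fconnect1 f i) (IH _ _).
by have := hf i ir; lia.
Qed.

Lemma rooted_root f : rooted f -> f r = r.
Proof. by case/andP=> /eqP. Qed.

Lemma set2_eq (i j k l : V) :
  [set i; j] = [set k; l] -> (i = k /\ j = l) \/ (i = l /\ j = k).
Proof.
move=> e.
have /set2P hi : i \in [set k; l] by rewrite -e set21.
have /set2P hj : j \in [set k; l] by rewrite -e set22.
have /set2P hk : k \in [set i; j] by rewrite e set21.
have /set2P hl : l \in [set i; j] by rewrite e set22.
case: hi hj hk hl => -> [] -> [] ? [] ?; subst; by auto.
Qed.

Lemma rooted_neq f i : rooted f -> i != r -> f i != i.
Proof.
move=> /rooted_height [h hf] ir; apply/eqP => fi.
by have := hf i ir; rewrite fi ltnn.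
Qed.

Lemma parent_edge_inj f : rooted f ->
  {in predC1 r &, injective (fun i => [set i; f i])}.
Proof.
move=> /rooted_height [h hf] i j; rewrite !inE => ir jr /set2_eq [] [] // ij fij.
by have := hf i ir; have := hf j jr; rewrite fij -ij; lia.
Qed.

Lemma parent_edgesP f e :
  reflect (exists2 i, i != r & e = [set i; f i]) (e \in parent_edges f).
Proof. by apply: (iffP imsetP) => -[j]; rewrite ?inE => jr ->; exists j. Qed.

Lemma adj_parent_edges f u v : adj (parent_edges f) u v ->
  (u != r /\ v = f u) \/ (v != r /\ u = f v).
Proof.
case/parent_edgesP=> i ir /set2_eq [] [-> ->]; by auto.
Qed.

Lemma parent_edges_adj f i : i != r -> adj (parent_edges f) i (f i).
Proof. by move=> ir; apply/parent_edgesP; exists i. Qed.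

Lemma adjC F : ssrbool.symmetric (adj F).
Proof. by move=> u v; rewrite /adj /= setUC. Qed.

Lemma connect_adjC F : connect_sym (adj F).
Proof. by apply: sym_connect_sym; exact: adjC. Qed.

Lemma parent_edges_connected f : rooted f -> connected_graph (parent_edges f).
Proof.
move=> rf.
have toroot i : connect (adj (parent_edges f)) i r.
  have [h hf] := rooted_height rf.
  have [n] := ubnP (h i); elim: n i => // n IH i hi.
  have [->|ir] := eqVneq i r; first exact: connect0.
  apply: connect_trans (connect1 (parent_edges_adj f ir)) (IH _ _).
  by have := hf i ir; lia.
move=> u v; apply: connect_trans (toroot u) _.
by rewrite connect_adjC.
Qed.

Lemma prev_neq_next (c : seq V) x :
  (2 < size c)%N -> uniq c -> x \in c -> prev c x != next c x.
Proof.
move=> sc uc xc.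
case: (rot_to xc) => i c' rc.
have uc' : uniq (x :: c') by rewrite -rc rot_uniq.
rewrite -(next_rot i uc) -(prev_rot i uc) rc.
have : (2 < size (x :: c'))%N by rewrite -rc size_rot.
case: c' uc' {rc} => [|y [|z c']] // uc' _.
have -> : next [:: x, y, z & c'] x = y by rewrite /= eqxx.
have -> : prev [:: x, y, z & c'] x = last z c'.
  have H s a : x \notin s -> prev_at x x a s = last a s.
    elim: s a => [|b s IH] a /=; first by rewrite eqxx.
    by rewrite inE negb_or => /andP [/negPf -> /IH].
  by rewrite [LHS](H (y :: z :: c') x) //; case/andP: uc'.
case/and3P: uc' => _ yn _.
by apply: contraNneq yn => <-; rewrite mem_last.
Qed.

(** At a vertex of maximal height on a cycle both cycle neighbours must be its parent, because a
    child would be higher; but a cycle of length at least three has two different neighbours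
    there. *)
Lemma parent_edges_acyclic f : rooted f -> acyclic_graph (parent_edges f).
Proof.
move=> rf c sc uc cc.
have [h hf] := rooted_height rf.
have [x0 x0c] : exists x0, x0 \in c by case: c sc {uc cc} => // a c _; exists a; rewrite mem_head.
case: (@arg_maxnP _ x0 (mem c) h x0c) => x xc xmax.
have /eqP := prev_neq_next sc uc xc; apply.
have H y : y \in c -> adj (parent_edges f) x y -> y = f x.
  move=> yc /adj_parent_edges [[]//|[yr xy]].
  by have := xmax y yc; have := hf y yr; rewrite -xy => ? ?; lia.
rewrite (H (next c x)) ?mem_next ?(next_cycle cc xc) // (H (prev c x)) ?mem_prev //.
by rewrite adjC (prev_cycle cc xc).
Qed.

Lemma parent_edges_tree f : rooted f -> is_tree (parent_edges f).
Proof.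
move=> rf; split; [|exact: parent_edges_connected|exact: parent_edges_acyclic].
by move=> e /parent_edgesP [i ir ->]; rewrite cards2 eq_sym rooted_neq.
Qed.

(** The edge from [i] to [f i] could only be oriented the other way by [g]. Then [g] sends [f i] to
    [i], and by induction on height so does [f], which would make [i] lower than its own parent. *)
Lemma parent_edges_inj f g :
  rooted f -> rooted g -> parent_edges f = parent_edges g -> f =1 g.
Proof.
move=> rf rg fg i; have [h hf] := rooted_height rf.
have [n] := ubnP (h i); elim: n i => // n IH i hi.
have [->|ir] := eqVneq i r; first by rewrite !rooted_root.
have hfi := hf i ir.
have := parent_edges_adj f ir; rewrite fg => /adj_parent_edges [[]//|[fir ifi]].
have := IH (f i) ltac:(lia); rewrite -ifi => ffi.
by have := hf (f i) fir; rewrite ffi; lia.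
Qed.

Lemma bridge F a b : is_tree F -> [set a; b] \in F ->
  ~~ connect (adj (F :\ [set a; b])) a b.
Proof.
move=> [sF _ aF] ab; apply/negP => /connectP [p pp bl].
case/shortenP: pp bl => p' pp' up' _ bl.
have anb : a != b by have := sF _ ab; rewrite cards2; case: eqVneq.
apply: (aF (a :: p')) => //.
  case: p' pp' up' bl => [|c [|d p']] //=; first by move=> _ _ ab'; rewrite ab' eqxx in anb.
  by move=> /andP [+ _] _ ab'; rewrite -ab' /adj /= !inE eqxx.
rewrite /= rcons_path -bl; apply/andP; split; last by rewrite adjC.
by apply: sub_path pp' => x y; rewrite /adj /= !inE => /andP [].
Qed.

(* A breadth-first parent function: distances to the root decrease. *)
Lemma connected_rooted F : connected_graph F ->
  exists2 f : {ffun V -> V}, rooted f & forall i, i != r -> [set i; f i] \in F.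
Proof.
move=> cF.
have P i : exists k, [exists p : k.-tuple V, path (adj F) i p && (last i p == r)].
  have /connectP [p pp rl] := cF i r.
  by exists (size p); apply/existsP; exists (in_tuple p); rewrite pp -rl eqxx.
pose h i := ex_minn (P i).
have H i : i != r -> [exists j, adj F i j && (h j < h i)%N].
  move=> ir; rewrite /h; case: (ex_minnP (P i)) => k /existsP [[p sp] /= /andP [pp /eqP lr]] _.
  case: p sp pp lr => [|j p] /= sp pp lr; first by rewrite lr eqxx in ir.
  case/andP: pp => ij pp; apply/existsP; exists j; rewrite /= ij.
  case: (ex_minnP (P j)) => m _ mm; move/eqP: sp => <-; rewrite ltnS; apply: mm.
  by apply/existsP; exists (in_tuple p); rewrite pp lr eqxx.
pose f i := if i == r then r else odflt r [pick j | adj F i j && (h j < h i)%N].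
have Hf i : i != r -> adj F i (f i) && (h (f i) < h i)%N.
  move=> ir; rewrite /f (negPf ir); case: pickP => //= no.
  by have /existsP [j] := H i ir; rewrite no.
exists (finfun f).
  apply: (@height_rooted _ h); first by rewrite ffunE /f eqxx.
  by move=> i ir; rewrite ffunE; case/andP: (Hf i ir).
by move=> i ir; rewrite ffunE; case/andP: (Hf i ir).
Qed.

(** The parent edges already connect all vertices, so a further edge of [F] could be bypassed,
    although edges of a tree are bridges. *)
Lemma tree_parent_edges F : is_tree F ->
  exists2 f : {ffun V -> V}, rooted f & F = parent_edges f.
Proof.
move=> tF; have [sF cF aF] := tF.
have [f rf fF] := connected_rooted cF.
exists f => //; apply/eqP; rewrite eqEsubset; apply/andP; split; last first.
  by apply/subsetP => e /parent_edgesP [i ir ->]; exact: fF.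
apply/subsetP => e eF; apply: contraT => nef.
have /eqP/cards2P [a [b [anb eab]]] := sF e eF; subst e.
rewrite -(negPf (bridge tF eF)).
move: (parent_edges_connected rf a b); apply: connect_sub => x y xy.
apply: connect1; rewrite /adj /= !inE; apply/andP; split.
  by apply: contraNneq nef => <-.
by case/parent_edgesP: xy => i ir ->; exact: fF.
Qed.

Lemma sum_spanning_trees (K : comNzRingType) (E : {set {set V}}) (g : {set V} -> K) :
  \sum_(F in spanning_trees E) \prod_(e in F) g e =
  \sum_(f : {ffun V -> V} | rooted f && [forall (i | i != r), [set i; f i] \in E])
     \prod_(i | i != r) g [set i; f i].
Proof.
pose good : {set {ffun V -> V}} := [set f : {ffun V -> V} | rooted f && [forall (i | i != r), [set i; f i] \in E]].
have -> : spanning_trees E = [set parent_edges (f : {ffun V -> V}) | f in good].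
  apply/setP => F; rewrite inE; apply/andP/imsetP => [[FE /asboolP tF]|[f]].
    have [f rf Ff] := tree_parent_edges tF; exists f => //.
    rewrite inE rf; apply/forall_inP => i ir; apply: (subsetP FE).
    by rewrite Ff; apply/parent_edgesP; exists i.
  rewrite inE => /andP [rf /forall_inP fE] ->; split.
    by apply/subsetP => e /parent_edgesP [i ir ->]; exact: fE.
  by apply/asboolP; exact: parent_edges_tree.
rewrite big_imset /=; last first.
  move=> f1 f2; rewrite !inE => /andP [r1 _] /andP [r2 _] e; apply/ffunP.
  exact: parent_edges_inj.
rewrite [LHS](eq_bigl (fun f : {ffun V -> V} => rooted f && [forall (i | i != r), [set i; f i] \in E])); last by move=> f; rewrite inE.
apply: eq_bigr => f /andP [rf _].
by rewrite /parent_edges big_imset //=; exact: parent_edge_inj.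
Qed.

End RootedFunctions.

(** * The matrix-tree theorem *)

Section FinDeterminant.
Variables (K : comNzRingType) (V : finType).
Implicit Types (b c : V -> V -> K).

Definition fdet b : K := \det (\matrix_(i < #|V|, j < #|V|) b (enum_val i) (enum_val j)).

(** Instead of deleting row and column [r] of the Laplacian, row [r] is replaced by a unit vector:
    the determinant is the same and the index type stays [V]. The weights need not be symmetric. *)
Definition rooted_laplacian (r : V) c (i j : V) : K :=
  if i == r then (i == j)%:R else (\sum_k c i k) * (i == j)%:R - c i j.

Lemma eq_fdet b b' : b =2 b' -> fdet b = fdet b'.
Proof. by move=> bb; congr (\det _); apply/matrixP => i j; rewrite !mxE bb. Qed.

Lemma eq_rooted_laplacian r c c' i j :
  c =2 c' -> rooted_laplacian r c i j = rooted_laplacian r c' i j.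
Proof.
by move=> cc; rewrite /rooted_laplacian cc; under eq_bigr do rewrite cc.
Qed.

Lemma fdetE b : fdet b =
  \sum_(s : 'S_#|V|) (-1) ^+ s * \prod_(v : V) b v (enum_val (s (enum_rank v))).
Proof.
apply: eq_bigr => s _; congr (_ * _).
rewrite (reindex (@enum_rank V)) /=; last exact: onW_bij (enum_rank_bij V).
by apply: eq_bigr => v _; rewrite mxE enum_rankK.
Qed.

End FinDeterminant.

Lemma fdet_map (K K' : comNzRingType) (V : finType) (f : {rmorphism K -> K'}) (b : V -> V -> K) :
  f (fdet b) = fdet (fun i j => f (b i j)).
Proof. by rewrite /fdet -det_map_mx; congr (\det _); apply/matrixP => i j; rewrite !mxE. Qed.

Lemma rooted_laplacian_map (K K' : comNzRingType) (V : finType) (f : {rmorphism K -> K'})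
    (r : V) (c : V -> V -> K) (i j : V) :
  f (rooted_laplacian r c i j) = rooted_laplacian r (fun i j => f (c i j)) i j.
Proof.
rewrite /rooted_laplacian; case: ifP => _; first by rewrite rmorph_nat.
by rewrite rmorphB rmorphM rmorph_nat rmorph_sum.
Qed.

Section MatrixTree.
Variables (K : fieldType) (V : finType) (r : V).
Implicit Types (b c : V -> V -> K).

Lemma fdet0P b :
  reflect (exists2 z : V -> K, (exists v, z v != 0) & forall i, \sum_j b i j * z j = 0)
          (fdet b == 0).
Proof.
rewrite /fdet -det_tr; apply: (iffP det0P) => [[z nz zA]|[z [v vz] zb]].
  exists (fun v => z 0 (enum_rank v)).
    have [k kz] : exists k, z 0 k != 0 by apply/rV0Pn.
    by exists (enum_val k); rewrite enum_valK.
  move=> i; have /matrixP /(_ 0 (enum_rank i)) := zA; rewrite !mxE => {2}<-.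
  rewrite (reindex (@enum_val V predT)) /=; last exact: onW_bij (enum_val_bij V).
  by apply: eq_bigr => k _; rewrite !mxE enum_valK enum_rankK mulrC.
exists (\row_k z (enum_val k)).
  by apply/rV0Pn; exists (enum_rank v); rewrite mxE enum_rankK.
apply/matrixP => i k; rewrite !mxE -[RHS](zb (enum_val k)).
rewrite [RHS](reindex (@enum_val V predT)) /=; last exact: onW_bij (enum_val_bij V).
by apply: eq_bigr => j _; rewrite !mxE mulrC.
Qed.

Lemma sum_delta (i : V) (z : V -> K) : \sum_j (i == j)%:R * z j = z i.
Proof.
rewrite (bigD1 i) //= eqxx mul1r big1 ?addr0 // => j ji.
by rewrite eq_sym (negPf ji) mul0r.
Qed.

(** Row of a reduced incidence matrix for an arrow from [i] to [k]; at the root only the unit vector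
    remains. *)
Let rho (i k j : V) : K := (i == j)%:R - (i != r)%:R * (k == j)%:R.

(** If [f] is not rooted, the indicator of the vertices that never reach [r] is a kernel vector. If
    it is, a permutation with nonzero term sends every [v] to [v] or [f v]; by injectivity a moved
    vertex stays moved along its whole orbit, but [r] is fixed, so only the identity contributes. *)
Lemma fdet_parent (f : {ffun V -> V}) : f r = r ->
  fdet (fun i j => rho i (f i) j) = (rooted r f)%:R.
Proof.
move=> fr; case rf: (rooted r f); last first.
  apply/eqP/fdet0P; move: rf; rewrite /rooted fr eqxx /= => /negbT.
  rewrite negb_forall => /existsP [i0 i0r].
  have step i : i != r -> fconnect f (f i) r = fconnect f i r.
    move=> ir; apply/idP/idP => [|ireach].
      exact: connect_trans (fconnect1 f i).
    have := iter_findex ireach; case: (findex f i r) => [/eqP|k].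
      by rewrite /= (negPf ir).
    by rewrite iterSr => <-; exact: fconnect_iter.
  exists (fun i => (~~ fconnect f i r)%:R).
    by exists i0; rewrite i0r oner_neq0.
  move=> i; rewrite /rho.
  under eq_bigr do rewrite mulrBl -mulrA.
  rewrite sumrB -mulr_sumr !sum_delta.
  have [->|ir] := eqVneq i r; first by rewrite connect0 mul0r subrr.
  by rewrite step // mul1r subrr.
rewrite fdetE (bigD1 1%g) //= odd_perm1 expr0 mul1r [X in X + _]big1; last first.
  move=> v _; rewrite perm1 enum_rankK /rho eqxx.
  have [->|vr] := eqVneq v r; first by rewrite mul0r subr0.
  by rewrite (negPf (rooted_neq rf vr)) mulr0 subr0.
rewrite big1 ?addr0 // => s s1.
apply/eqP; rewrite mulf_eq0; apply/orP; right.
apply: contraR s1 => /prodf_neq0 nz.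
pose t v := enum_val (s (enum_rank v)).
have tinj : injective t by move=> u v /enum_val_inj /perm_inj /enum_rank_inj.
have tE v : t v = v \/ (v != r /\ t v = f v).
  have := nz v isT; rewrite /rho -/(t v).
  have [<-|vt] := eqVneq v (t v); first by left.
  rewrite sub0r oppr_eq0; have [vr|vr] := eqVneq v r; first by rewrite mul0r eqxx.
  rewrite mul1r; have [<-|_] := eqVneq (f v) (t v); first by right.
  by rewrite eqxx.
apply/eqP/permP => k; rewrite perm1; apply: enum_val_inj.
have -> : enum_val (s k) = t (enum_val k) by rewrite /t enum_valK.
move: (enum_val k) => v {k}.
apply/eqP; apply: contraT => tv.
have tr : t r = r by case: (tE r) => // [[]]; rewrite eqxx.
have step k : iter k t v = iter k f v /\ t (iter k t v) != iter k t v.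
  elim: k => [|k [IH1 IH2]] //=; split; last by rewrite (inj_eq tinj).
  by rewrite -IH1; case: (tE (iter k t v)) => [e|[]//]; rewrite e eqxx in IH2.
case/andP: rf => _ /forallP /(_ v) /iter_findex kr.
have [e] := step (findex f v r).
by rewrite e kr tr eqxx.
Qed.

(** Each Laplacian row is a combination of the rows [rho i k]. Multilinear expansion gives one
    determinant for every choice of [k] at each [i], that is, for every function [f], and the rooted
    ones survive. *)
Lemma fdet_rooted_laplacian c :
  fdet (rooted_laplacian r c) =
  \sum_(f : {ffun V -> V} | rooted r f) \prod_(i | i != r) c i (f i).
Proof.
(* At the root the only choice is [k = r], which enforces [f r = r]. *)
pose cc i k := if i == r then (k == r)%:R else c i k.
have lapE i j : rooted_laplacian r c i j = \sum_k cc i k * rho i k j.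
  rewrite /rooted_laplacian /cc; have [ir|ir] := boolP (i == r).
    under eq_bigr do rewrite /rho ir mul0r subr0.
    rewrite -mulr_suml (bigD1 r) //= eqxx big1 ?addr0 ?mul1r // => k kr.
    by rewrite (negPf kr).
  under [RHS]eq_bigr do rewrite /rho ir mul1r mulrBr.
  rewrite sumrB -mulr_suml; congr (_ - _).
  rewrite (bigD1 j) //= eqxx mulr1 big1 ?addr0 // => k kj.
  by rewrite (negPf kj) mulr0.
rewrite (eq_fdet lapE) fdetE.
under eq_bigr => s _ do rewrite bigA_distr_bigA big_distrr /=.
rewrite exchange_big /=.
have termE (f : {ffun V -> V}) :
    \sum_(s : 'S_#|V|) (-1) ^+ s *
       \prod_i (cc i (f i) * rho i (f i) (enum_val (s (enum_rank i)))) =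
    (\prod_i cc i (f i)) * fdet (fun i j => rho i (f i) j).
  rewrite fdetE big_distrr /=; apply: eq_bigr => s _.
  by rewrite big_split /= mulrCA.
under eq_bigr do rewrite termE.
rewrite [RHS]big_mkcond /=; apply: eq_bigr => f _.
have [fr|fr] := eqVneq (f r) r.
  rewrite fdet_parent //; case: ifP => _; last by rewrite mulr0.
  rewrite mulr1 (bigD1 r) //= {1}/cc eqxx fr eqxx mul1r.
  by apply: eq_bigr => i ir; rewrite /cc (negPf ir).
rewrite /rooted (negPf fr) /= (bigD1 r) //= /cc eqxx (negPf fr).
by rewrite !mul0r.
Qed.

End MatrixTree.

(** * Stability as rigidity *)

Section Balanced.
Variables (R : realType) (V : finType).
Implicit Types (W : V -> V -> R) (U : {set V}) (x z : V -> R[i]).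
Local Notation toC := (real_complex R).

Definition upper (y : R[i]) : bool := 0 < complex.Im y.

(** Row [i] of the Laplacian with edge weights [W i j * x i * x j], divided by [x i]. *)
Definition balanced W U x z : Prop :=
  {in U, forall i, \sum_(j in U) toC (W i j) * x j * (z j - z i) = 0}.

Definition rigid W U : Prop :=
  forall x z, {in U, forall i, upper (x i)} -> balanced W U x z ->
    {in U &, forall i j, z i = z j}.

Lemma upper_neq0 y : upper y -> y != 0.
Proof. by rewrite /upper; apply: contraTneq => ->; rewrite ltxx. Qed.

Lemma upperD y y' : upper y -> upper y' -> upper (y + y').
Proof. case: y y' => [a b] [a' b']; rewrite /upper /= => *; exact: addr_gt0. Qed.

Lemma upperM a y : 0 < a -> upper y -> upper (toC a * y).
Proof. by case: y => [b c]; rewrite /upper /= mul0r addr0; exact: mulr_gt0. Qed.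

Lemma upper_sum (I : finType) (P : pred I) (y : I -> R[i]) (i0 : I) :
  P i0 -> (forall i, P i -> upper (y i)) -> upper (\sum_(i | P i) y i).
Proof.
move=> Pi0 uy; rewrite (bigD1 i0) //=.
have : 0 <= complex.Im (\sum_(i | P i && (i != i0)) y i).
  elim/big_rec: _ => // i [c d] /andP [/uy ui _] /= hd.
  by move: ui; case: (y i) => [a b]; rewrite /upper /= => /ltW hb; exact: addr_ge0.
move: (uy _ Pi0); case: (y i0) (\sum_(_ | _) _) => [a b] [c d].
by rewrite /upper /=; exact: ltr_pwDl.
Qed.

(** Row [r] forces a kernel vector to vanish at [r]. The other rows only see differences, so
    subtracting a constant normalises any solution. *)
Lemma rooted_laplacian0P (r : V) (c : V -> V -> R[i]) :
  reflect (exists2 z : V -> R[i], exists v, z v != z r &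
             forall i, i != r -> \sum_j c i j * (z j - z i) = 0)
          (fdet (rooted_laplacian r c) == 0).
Proof.
have rowE (z : V -> R[i]) i : i != r ->
    \sum_j rooted_laplacian r c i j * z j = - \sum_j c i j * (z j - z i).
  move=> ir; rewrite /rooted_laplacian (negPf ir).
  under eq_bigr do rewrite mulrBl -mulrA.
  rewrite sumrB -mulr_sumr sum_delta mulr_suml -sumrB -sumrN.
  by apply: eq_bigr => j _; rewrite mulrBr opprB.
have rowr (z : V -> R[i]) : \sum_j rooted_laplacian r c r j * z j = z r.
  by rewrite /rooted_laplacian eqxx sum_delta.
apply: (iffP (fdet0P _)) => [[z [v vz] eqz]|[z [v vz] eqz]].
  have zr : z r = 0 by rewrite -rowr eqz.
  exists z; first by exists v; rewrite zr.
  by move=> i ir; apply/eqP; rewrite -oppr_eq0 -rowE // eqz.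
exists (fun j => z j - z r); first by exists v; rewrite subr_eq0.
move=> i; have [->|ir] := eqVneq i r; first by rewrite rowr subrr.
rewrite rowE //; apply/eqP; rewrite oppr_eq0 -[X in _ == X](eqz i ir); apply/eqP.
by apply: eq_bigr => j _; congr (_ * _); ring.
Qed.

Lemma balanced_setT W x z :
  balanced W setT x z <-> forall i, \sum_j toC (W i j) * x j * (z j - z i) = 0.
Proof.
by split=> bal i; [rewrite -[RHS](bal i) // | move=> _; rewrite -[RHS](bal i)];
  apply: eq_bigl => j; rewrite inE.
Qed.

(* The equation at the root follows from the others: the x-weighted sum of all equations vanishes by symmetry. *)
Lemma balanced_root W (r : V) x z : (forall i j, W i j = W j i) -> x r != 0 ->
  (forall i, i != r -> \sum_j toC (W i j) * x j * (z j - z i) = 0) ->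
  \sum_j toC (W r j) * x j * (z j - z r) = 0.
Proof.
move=> Ws xr eqs.
have : \sum_i x i * (\sum_j toC (W i j) * x j * (z j - z i)) = 0.
  pose T := \sum_i \sum_j x i * (toC (W i j) * x j * z j).
  transitivity (T - T); last exact: subrr.
  rewrite {2}/T exchange_big /= -sumrB; apply: eq_bigr => i _.
  rewrite mulr_sumr -sumrB; apply: eq_bigr => j _.
  by rewrite (Ws j i); ring.
rewrite (bigD1 r) //= [X in _ + X]big1 ?addr0; last first.
  by move=> i ir; rewrite eqs // mulr0.
by move/eqP; rewrite mulf_eq0 (negPf xr) => /eqP.
Qed.

Lemma rigid_setT_fdet W (r : V) : (forall i j, W i j = W j i) ->
  rigid W setT <->
  forall x, (forall i, upper (x i)) ->
    fdet (rooted_laplacian r (fun i j => toC (W i j) * x j)) != 0.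
Proof.
move=> Ws; split=> [rig x ux|nz x z ux bal i j _ _].
  apply/rooted_laplacian0P => -[z [v vz] eqs].
  case/eqP: vz; apply: (rig x) => //; apply/balanced_setT => i.
  have [->|ir] := eqVneq i r; last exact: eqs.
  by apply: balanced_root => //; exact: upper_neq0.
have zr v : z v = z r.
  apply/eqP; apply: contraT => vz.
  have /negP [] := nz x (fun i => ux i (in_setT i)).
  apply/rooted_laplacian0P; exists z; first by exists v.
  by move=> k _; exact: (iffLR (balanced_setT W x z) bal k).
by rewrite !zr.
Qed.

End Balanced.

Section StablePolynomial.
Variables (R : realType) (V : finType) (E : {set {set V}}) (w : {set V} -> R).
Local Notation toC := (real_complex R).

Definition wadj (i j : V) : R := if [set i; j] \in E then w [set i; j] else 0.

Lemma wadjC i j : wadj i j = wadj j i.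
Proof. by rewrite /wadj setUC. Qed.

Lemma meval_vertex_spanning_poly (y : 'I_#|V| -> R[i]) :
  (map_mpoly (real_complex R) (vertex_spanning_poly E w)).@[y] =
  \sum_(F in spanning_trees E)
    (\prod_(e in F) toC (w e)) * \prod_v y (enum_rank v) ^+ (deg F v).-1.
Proof.
rewrite /vertex_spanning_poly (rmorph_sum (map_mpoly toC)) (rmorph_sum (meval y)).
apply: eq_bigr => F _.
rewrite /= map_mpolyZ mevalZ rmorph_prod; congr (_ * _).
rewrite (rmorph_prod (map_mpoly toC)) (rmorph_prod (meval y)); apply: eq_bigr => v _.
by rewrite (rmorphXn (map_mpoly toC)) (rmorphXn (meval y)) /= map_mpolyX mevalXU.
Qed.

Lemma connected_deg_gt0 (F : {set {set V}}) v :
  (1 < #|V|)%N -> connected_graph F -> (0 < deg F v)%N.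
Proof.
move=> hV cF.
have [u uv] : exists u, u != v.
  apply/existsP; rewrite -negb_forall; apply: contraTN hV => /forallP all.
  rewrite -leqNgt; apply: (@leq_trans #|[set v]|); last by rewrite cards1.
  by apply: subset_leq_card; apply/subsetP => u _; rewrite inE; exact: all.
have /connectP [[|a p] /= pp e] := cF v u; first by rewrite e eqxx in uv.
apply/card_gt0P; exists [set v; a]; rewrite inE set21 andbT.
by case/andP: pp.
Qed.

Hypotheses (hV : (1 < #|V|)%N) (sE : simple_graph E).

(** Orienting a tree towards [r] gives the weight [x (f i)] to each edge. Multiplying by the [x i]
    with [i != r] makes this symmetric, with [x v] to the power [deg F v]; the same product and
    [x r] restore the missing factor of each [x v] on the left. *)
Lemma vertex_spanning_poly_fdet (r : V) (x : V -> R[i]) : (forall i, x i != 0) ->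
  x r * (\sum_(F in spanning_trees E)
    (\prod_(e in F) toC (w e)) * \prod_v x v ^+ (deg F v).-1) =
  fdet (rooted_laplacian r (fun i j => toC (wadj i j) * x j)).
Proof.
move=> nx.
have nzp : \prod_(i | i != r) x i != 0 by apply/prodf_neq0 => i _.
apply: (mulfI nzp).
pose g (e : {set V}) := toC (w e) * \prod_(v in e) x v.
transitivity (\sum_(F in spanning_trees E) \prod_(e in F) g e).
  have prodE : \prod_i x i = (\prod_(i | i != r) x i) * x r by rewrite (bigD1 r) //= mulrC.
  rewrite mulrA -prodE big_distrr /=.
  apply: eq_bigr => F; rewrite inE => /andP [_ /asboolP [_ cF _]].
  rewrite /g big_split /= mulrCA; congr (_ * _).
  rewrite [RHS](exchange_big_dep predT) //= -big_split /=; apply: eq_bigr => v _.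
  rewrite -exprS prednK ?connected_deg_gt0 //.
  rewrite prodr_const /deg; congr (_ ^+ _).
  by apply: eq_card => e; rewrite !inE.
rewrite (sum_spanning_trees r) fdet_rooted_laplacian big_distrr /=.
rewrite [RHS](bigID (fun f : {ffun V -> V} => [forall (i | i != r), [set i; f i] \in E])) /=.
rewrite [X in _ + X]big1 ?addr0; last first.
  move=> f /andP [_]; rewrite negb_forall_in => /exists_inP [i ir fi].
  by rewrite [X in _ * X](bigD1 i) //= /wadj (negPf fi) !mul0r mulr0.
apply: eq_bigr => f /andP [rf /forall_inP fE].
rewrite -big_split /=; apply: eq_bigr => i ir.
rewrite /g /wadj fE // big_setU1 ?big_set1; last by rewrite inE eq_sym (rooted_neq rf).
by rewrite mulrCA.
Qed.

Lemma weighted_stable_rigid : weighted_stable E w <-> rigid wadj setT.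
Proof.
have /card_gt0P [r _] : (0 < #|V|)%N by exact: ltnW.
rewrite (rigid_setT_fdet r wadjC); split=> [st x ux|nz y uy].
  rewrite -vertex_spanning_poly_fdet => [|i]; last exact: upper_neq0.
  apply: mulf_neq0; first exact: upper_neq0.
  have := st (fun k => x (enum_val k)) (fun k => ux (enum_val k)).
  rewrite meval_vertex_spanning_poly => nz; apply: contraNN nz => /eqP eq0; apply/eqP; rewrite -[RHS]eq0.
  by apply: eq_bigr => F _; congr (_ * _); apply: eq_bigr => v _; rewrite enum_rankK.
rewrite meval_vertex_spanning_poly.
have := nz (fun v => y (enum_rank v)) (fun v => uy (enum_rank v)).
rewrite -vertex_spanning_poly_fdet => [|i]; last by apply: upper_neq0; exact: uy.
by rewrite mulf_eq0 negb_or => /andP [].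
Qed.

End StablePolynomial.

(** * Sides of a cubic tree *)

Section TreeCuts.
Variable T : finType.
Implicit Types (F : {set {set T}}) (e : {set T}) (a b c x y : T).

Lemma connect_preserves (s : rel T) (P : pred T) a b :
  P a -> (forall x y, P x -> s x y -> P y) -> connect s a b -> P b.
Proof.
move=> Pa step /connectP [p]; elim: p a Pa => [|c p IH] a Pa /=; first by move=> _ ->.
by case/andP=> ac; apply: IH; exact: step ac.
Qed.

Lemma connect_delete F a b x : connected_graph F ->
  connect (adj (F :\ [set a; b])) a x || connect (adj (F :\ [set a; b])) b x.
Proof.
move=> cF; pose P y := connect (adj (F :\ [set a; b])) a y || connect (adj (F :\ [set a; b])) b y.
apply: (@connect_preserves (adj F) P a x) => //; first by rewrite /P connect0.
rewrite /P {P}.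
move=> y y' reach yy'; have [e|ne] := eqVneq [set y; y'] [set a; b].
  have : y' \in [set a; b] by rewrite -e set22.
  by case/set2P => ->; rewrite connect0 ?orbT.
have yy'' : connect (adj (F :\ [set a; b])) y y'.
  by apply: connect1; rewrite /adj /= !inE ne.
by case/orP: reach => /connect_trans /(_ yy'') ->; rewrite ?orbT.
Qed.

Lemma connect_leaf F e a x : deg F a = 1%N -> e \in F -> a \in e ->
  connect (adj (F :\ e)) a x -> x = a.
Proof.
move=> da eF ae /connectP [[|c p] /= pp ->] //.
case/andP: pp; rewrite /adj /= !inE => /andP [ne acF] _.
have /eqP/cards1P [e0 De] := da.
have He : e \in [set e0] by rewrite -De inE eF.
have Hc : [set a; c] \in [set e0] by rewrite -De inE acF set21.
by move: He Hc ne; rewrite !inE => /eqP -> /eqP ->; rewrite eqxx.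
Qed.

(** On a simple path from [a], everything after the first step avoids [a] and so cannot reuse the
    first edge. *)
Lemma connect_step F e a x : connect (adj (F :\ e)) a x -> x != a ->
  exists c, [/\ [set a; c] \in F, [set a; c] != e & connect (adj (F :\ [set a; c])) c x].
Proof.
move=> /connectP [p pp xl] xa; case/shortenP: pp xl => -[|c p'] /= pp up _ xl.
  by rewrite xl eqxx in xa.
case/andP: pp; rewrite {1}/adj /= !inE => /andP [ne acF] pp.
exists c; split=> //; apply/connectP; exists p' => //.
case/andP: up => ap _.
apply: (sub_in_path (P := predC1 a)) pp; last first.
  by apply/allP => y yp; apply: contraNneq ap => <-.
move=> y y'; rewrite !inE => ya y'a; rewrite /adj /= !inE => /andP [_ ->].
rewrite andbT; apply/eqP => h; have := set21 a c.
by rewrite -h !inE !(eq_sym a) (negPf ya) (negPf y'a).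
Qed.

(** Walking away from [b] across [a] loses at least the node [a]. This strict decrease drives the
    minimality argument below. *)
Lemma component_subset F a b c : is_tree F ->
  [set a; c] \in F -> [set a; c] != [set a; b] ->
  [set y | connect (adj (F :\ [set a; c])) c y] \proper
  [set y | connect (adj (F :\ [set a; b])) a y].
Proof.
move=> tF acF ne.
have nca : ~~ connect (adj (F :\ [set a; c])) c a.
  by rewrite connect_adjC; exact: bridge.
apply/properP; split; last by exists a; rewrite inE ?connect0.
apply/subsetP => y; rewrite !inE => cy.
have ac : connect (adj (F :\ [set a; b])) a c.
  by apply: connect1; rewrite /adj /= !inE ne.
apply: connect_trans ac _.
pose P y := connect (adj (F :\ [set a; c])) c y && connect (adj (F :\ [set a; b])) c y.
suff /andP [] : P y by [].
apply: (@connect_preserves _ P _ y _ _ cy); first by rewrite /P !connect0.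
rewrite /P {P} => u v /andP [cu cu'] uv; have cv := connect_trans cu (connect1 uv).
rewrite cv; apply: connect_trans cu' (connect1 _).
move: uv; rewrite /adj /= !inE => /andP [_ ->]; rewrite andbT; apply/eqP => h.
have : a \in [set u; v] by rewrite h set21.
by case/set2P => au; [move: cu|move: cv]; rewrite -au (negPf nca).
Qed.

End TreeCuts.

Section LeafTree.
Variables (V : finType) (T : leaf_tree V).
Implicit Types (e : {set node T}) (a : node T) (v : V).
Let F := tree_edges T.

Lemma leaf_deg v : deg F (leaf T v) = 1%N.
Proof. by apply/leafP; exists v. Qed.

Lemma leaf_edge v : exists2 b, [set leaf T v; b] \in F & leaf T v != b.
Proof.
have : (0 < deg F (leaf T v))%N by rewrite leaf_deg.
case/card_gt0P => e; rewrite inE => /andP [eF ve].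
have [sF _ _] := tree_edgesP T.
have /eqP/cards2P [x [y [xy exy]]] := sF e eF.
move: ve eF; rewrite exy => /set2P [] ->; first by exists y.
by rewrite setUC; exists x; rewrite // eq_sym.
Qed.

Lemma side_leaf v e : e \in F -> leaf T v \in e -> side e (leaf T v) = [set v].
Proof.
move=> eF ve; apply/setP => u; rewrite !inE; apply/idP/eqP => [|->]; last exact: connect0.
by move/(connect_leaf (leaf_deg v) eF ve)/leaf_inj.
Qed.

(* A side that is minimal among those meeting U twice splits at its end node into two sides meeting U at most once. *)
Lemma side_meets_twice (U : {set V}) : (2 < #|U|)%N ->
  exists e a, [/\ e \in F, a \in e & #|side e a :&: U| = 2%N].
Proof.
move=> U3; have tF := tree_edgesP T; have [sF cF _] := tF.
pose comp (p : {set node T} * node T) := [set y | connect (adj (F :\ p.1)) p.2 y].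
pose P (p : {set node T} * node T) :=
  [&& p.1 \in F, p.2 \in p.1 & (1 < #|side p.1 p.2 :&: U|)%N].
(* The far side of the edge at a leaf [u] misses only [u], so it still meets [U] twice. *)
have [p0 Pp0] : exists p0, P p0.
  have /card_gt0P [u uU] : (0 < #|U|)%N by lia.
  have [b ebF ub] := leaf_edge u.
  exists ([set leaf T u; b], b); rewrite /P /= ebF set22 /=.
  apply: (@leq_trans #|U :\ u|); first by move: U3; rewrite (cardsD1 u) uU; lia.
  apply: subset_leq_card; apply/subsetP => v; rewrite !inE => /andP [vu ->].
  rewrite andbT; have := connect_delete (leaf T u) b (leaf T v) cF.
  case/orP=> // /(connect_leaf (leaf_deg u) ebF (set21 _ _)) /leaf_inj vu'.
  by rewrite vu' eqxx in vu.
(* Minimality counts tree nodes rather than leaves, because only the node component is certain to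
   shrink strictly. *)
case: (@arg_minnP _ p0 P (fun p => #|comp p|) Pp0) => -[e a] /and3P [/= eF ae U2] pmin.
exists e, a; split=> //; apply/eqP; rewrite eqn_leq U2 andbT.
have [b eab] : exists b, e = [set a; b].
  have /eqP/cards2P [x [y [xy exy]]] := sF e eF.
  by move: ae; rewrite exy => /set2P [] ->; [exists y|exists x; rewrite setUC].
have da : deg F a <> 1%N.
  move=> da; have [v av] := iffLR (leafP _) da.
  have : (#|side e a :&: U| <= #|[set v]|)%N.
    by apply: subset_leq_card; rewrite av side_leaf ?subsetIl // -av.
  by rewrite cards1; lia.
have [e1 [e2 [e12 De]]] : exists e1 e2, e1 != e2 /\ [set e' in F | a \in e'] :\ e = [set e1; e2].
  apply/cards2P; have : deg F a = 3%N := innerP da; rewrite /deg (cardsD1 e [set e' in F | a \in e']).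
  have -> : e \in [set e' in F | a \in e'] by rewrite inE eF.
  by rewrite add1n => -[->].
have Hc e' : e' \in [set e1; e2] ->
    exists2 c, e' = [set a; c] & (#|side e' c :&: U| <= 1)%N.
  rewrite -De !inE => /and3P [ne e'F ae'].
  have [c eac] : exists c, e' = [set a; c].
    have /eqP/cards2P [x [y [xy exy]]] := sF e' e'F.
    by move: ae'; rewrite exy => /set2P [] ->; [exists y|exists x; rewrite setUC].
  exists c => //; rewrite leqNgt; apply/negP => U2'.
  have : P (e', c) by rewrite /P /= e'F U2' eac set22.
  move/pmin; rewrite leqNgt => /negP; apply; apply: proper_card.
  by rewrite /comp /= eac eab; apply: component_subset; rewrite -?eac -?eab.
have [c1 ec1 U1] := Hc e1 (set21 _ _).
have [c2 ec2 U2'] := Hc e2 (set22 _ _).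
apply: (@leq_trans #|(side e1 c1 :&: U) :|: (side e2 c2 :&: U)|); last first.
  by rewrite cardsU; lia.
apply: subset_leq_card; apply/subsetP => v; rewrite !inE => /andP [av ->].
rewrite !andbT.
have va : leaf T v != a by apply/eqP => va; apply: da; rewrite -va leaf_deg.
have [c [acF ne cv]] := connect_step av va.
have : [set a; c] \in [set e1; e2] by rewrite -De !inE ne acF eqxx.
have ca c' : c != a -> [set a; c] = [set a; c'] -> c = c'.
  by move=> ca /set2_eq [[]//|[-> ]].
have cna : c != a by have := sF _ acF; rewrite cards2 eq_sym; case: eqVneq.
case/set2P => ee.
  have cc1 : c = c1 by apply: ca; rewrite // ee.
  by rewrite -cc1 -ee cv.
have cc2 : c = c2 by apply: ca; rewrite // ee.
by rewrite -cc2 -ee cv orbT.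
Qed.

End LeafTree.

(** * Cut rank at most one in terms of two-by-two minors *)

Section CutRank.
Variables (R : realType) (V : finType).

Lemma mxrank_le1P m n (A : 'M[R]_(m, n)) :
  (\rank A <= 1)%N <-> forall i i' k k', A i k * A i' k' = A i k' * A i' k.
Proof.
split=> [|minor].
  have := esym (mulmx_base A).
  move: (\rank A) (col_base A) (row_base A) => [|[|q]] B D -> // _ i i' k k'.
    by rewrite !mxE !big_ord0 !mul0r.
  by rewrite !mxE !big_ord1; ring.
have [->|nz] := eqVneq A 0; first by rewrite mxrank0.
have [i [k ik]] : exists i k, A i k != 0.
  apply: contrapT => no; case/eqP: nz; apply/matrixP => i k; rewrite mxE.
  by apply/eqP; apply: contraT => ik; case: no; exists i, k.
have -> : A = col k A *m ((A i k)^-1 *: row i A).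
  apply/matrixP => i' k'; rewrite !mxE big_ord1 !mxE.
  by rewrite mulrCA (minor i' i k k') mulrC mulfK.
exact: leq_trans (mxrankM_maxl _ _) (rank_leq_col _).
Qed.

(** Rank at most one: zero blocks are included. *)
Definition rank_one (W : V -> V -> R) (A B : {set V}) : Prop :=
  forall i i' k k', i \in A -> i' \in A -> k \in B -> k' \in B ->
    W i k * W i' k' = W i k' * W i' k.

Lemma rank_oneC W A B : (forall i j, W i j = W j i) -> rank_one W A B -> rank_one W B A.
Proof.
move=> Ws ro i i' k k' iB i'B kA k'A.
by rewrite (Ws i k) (Ws i' k') (Ws i k') (Ws i' k) (ro k k' i i') // mulrC.
Qed.

Lemma rank_oneS W (A B A' B' : {set V}) : A' \subset A -> B' \subset B -> rank_one W A B -> rank_one W A' B'.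
Proof.
move=> /subsetP sA /subsetP sB ro i i' k k' iA i'A kB k'B.
by apply: ro; auto.
Qed.

Lemma cut_rank_le1P (E : {set {set V}}) (w : {set V} -> R) (A : {set V}) :
  (cut_rank E w A <= 1)%N <-> rank_one (wadj E w) (~: A) A.
Proof.
rewrite /cut_rank mxrank_le1P; split=> [minor i i' k k' iA i'A kA k'A|ro i i' k k'].
  have := minor (enum_rank_in iA i) (enum_rank_in i'A i') (enum_rank_in kA k) (enum_rank_in k'A k').
  by rewrite !mxE /= !enum_rankK !enum_rankK_in.
by rewrite !mxE /= !enum_rankK; apply: ro; exact: enum_valP.
Qed.

End CutRank.

(** * Width one implies rigidity *)

Section Merging.
Variables (R : realType) (V : finType) (W : V -> V -> R).
Hypotheses (Wsym : forall i j, W i j = W j i) (Wge0 : forall i j, 0 <= W i j).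
Implicit Types (U A : {set V}) (x z : V -> R[i]).
Local Notation toC := (real_complex R).

(** Connectivity of the support of [W] on [U], in cut form: merging two vertices then needs no
    surgery on paths. *)
Definition wconnected U : Prop :=
  forall A, A \subset U -> A != set0 -> A != U ->
    exists i j, [/\ i \in A, j \in U :\: A & W i j != 0].

Lemma ge0_ImM a (y : R[i]) : 0 <= a -> upper y -> 0 <= complex.Im (toC a * y).
Proof.
case: y => [b c]; rewrite /upper /= mul0r addr0 => a0 /ltW; exact: mulr_ge0.
Qed.

Lemma ImD (y y' : R[i]) : complex.Im (y + y') = complex.Im y + complex.Im y'.
Proof. by case: y y' => [? ?] [? ?]. Qed.

Lemma Im_weighted_sum_gt0 (P : pred V) (a : V -> R) x j :
  (forall i, P i -> 0 <= a i) -> (forall i, P i -> upper (x i)) -> P j -> a j != 0 ->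
  upper (\sum_(i | P i) toC (a i) * x i).
Proof.
move=> a0 ux Pj aj; rewrite (bigD1 j) //= /upper ImD.
apply: ltr_pwDl; first by apply: upperM; rewrite ?ux // lt_neqAle eq_sym aj a0.
elim/big_rec: _ => // i y /andP [Pi _] hy.
by rewrite ImD addr_ge0 // ge0_ImM ?a0 ?ux.
Qed.

Section Step.
Variables (U : {set V}) (u v : V) (c : R).
Hypotheses (uU : u \in U) (vU : v \in U) (uv : u != v) (c0 : 0 <= c).
Hypothesis prop : forall k, k \in U :\: [set u; v] -> W u k = c * W v k.
Hypothesis connU : wconnected U.

(** Any nonzero entry of [u] towards a third vertex is matched by a nonzero entry of [v], so [v]
    takes over the cut edges of [u]. *)
Lemma wconnectedD1 : wconnected (U :\ u).
Proof.
move=> A AU A0 AnU.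
have uA : u \notin A by apply/negP => /(subsetP AU); rewrite !inE eqxx.
have [vA|vA] := boolP (v \in A).
  have [|||i [j [iA jA ij]]] := connU (A := u |: A).
  - by apply/subsetP => k; rewrite !inE => /orP [/eqP -> //|/(subsetP AU)]; rewrite !inE => /andP [].
  - by apply/set0Pn; exists u; rewrite !inE eqxx.
  - by apply: contra_neq AnU => <-; rewrite setU1K.
  move: jA; rewrite !inE negb_or => /andP [/andP [ju jA] jU].
  have jv : j != v by apply: contraNneq jA => ->.
  move: iA; rewrite !inE => /orP [/eqP iu|iA].
    exists v, j; split; rewrite ?inE ?ju ?jA //.
    move: ij; rewrite iu prop ?inE ?negb_or ?ju ?jv //.
    by rewrite mulf_eq0 negb_or => /andP [].
  by exists i, j; rewrite !inE ju jA jU.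
have [|||i [j [iA jA ij]]] := connU (A := A).
- by apply: subset_trans AU (subsetDl _ _).
- by [].
- by apply: contraNneq uA => ->.
move: jA; rewrite !inE => /andP [jA jU].
have [ju|ju] := eqVneq j u; last by exists i, j; rewrite !inE ju jA jU.
have /(subsetP AU) : i \in A by []. rewrite !inE => /andP [iu iU].
have iv : i != v by apply: contraNneq vA => <-.
exists i, v; split; rewrite ?inE ?vA ?vU ?(eq_sym v) ?uv //.
move: ij; rewrite ju Wsym prop ?inE ?negb_or ?iu ?iv // mulf_eq0 negb_or => /andP [_].
by rewrite Wsym.
Qed.

Variables (x z : V -> R[i]).
Hypotheses (ux : {in U, forall i, upper (x i)}) (bal : balanced W U x z).

Let B := U :\: [set u; v].

Lemma big_split_pair (g : V -> R[i]) :
  \sum_(j in U) g j = g u + g v + \sum_(j in B) g j.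
Proof.
rewrite (bigD1 u) //= (bigD1 v) /=; last by rewrite vU eq_sym.
rewrite addrA; congr (_ + _); apply: eq_bigl => j.
by rewrite !inE negb_or -andbA andbC.
Qed.

(** Take [c] times the equation at [v] minus the equation at [u]. The unknown values on the rest of
    [U] cancel by proportionality, leaving a coefficient times [z u - z v]. *)
Lemma twin_values : z u = z v.
Proof.
have eu := bal uU; have ev := bal vU.
rewrite big_split_pair in eu; rewrite big_split_pair in ev.
pose S := \sum_(j in B) toC (W v j) * x j.
pose Q := \sum_(j in B) toC (W v j) * x j * z j.
have Ev : \sum_(j in B) toC (W v j) * x j * (z j - z v) = Q - S * z v.
  by rewrite mulr_suml -sumrB; apply: eq_bigr => j _; rewrite mulrBr.
have Eu : \sum_(j in B) toC (W u j) * x j * (z j - z u) = toC c * (Q - S * z u).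
  rewrite mulr_suml -sumrB mulr_sumr; apply: eq_bigr => j jB.
  by rewrite prop // rmorphM; ring.
(* The first two terms add up to the sum of [W u j * x j] over [j != u], which lies in the upper
   half-plane because [u] has a neighbour in [U]; the last term cannot lower the imaginary part. *)
have up : upper (toC (W u v) * x v + toC c * S + toC (c * W u v) * x u).
  have [|||i [j [iu jU ij]]] := connU (A := [set u]).
  - by rewrite sub1set.
  - by apply/set0Pn; exists u; rewrite inE.
  - by apply: contraTneq vU => <-; rewrite inE eq_sym.
  move: iu jU ij; rewrite !inE => /eqP -> /andP [ju jU] uj.
  have -> : toC (W u v) * x v + toC c * S = \sum_(j in U :\ u) toC (W u j) * x j.
    rewrite (bigD1 v) /=; last by rewrite !inE eq_sym uv.
    congr (_ + _); rewrite mulr_sumr.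
    rewrite [RHS](eq_bigl (mem B)); last first.
      by move=> k; rewrite !inE negb_or andbAC.
    by apply: eq_bigr => k kB; rewrite prop // rmorphM mulrA.
  rewrite /upper ImD; apply: ltr_wpDr; first by rewrite ge0_ImM ?mulr_ge0 // ux.
  apply: (@Im_weighted_sum_gt0 _ _ _ j) => //; first by move=> k; rewrite !inE => /andP [_ /ux].
  by rewrite !inE ju.
apply/eqP; rewrite -subr_eq0; apply/eqP; apply: (mulfI (upper_neq0 up)).
rewrite mulr0.
rewrite Eu in eu; rewrite Ev in ev.
have -> : (toC (W u v) * x v + toC c * S + toC (c * W u v) * x u) * (z u - z v) =
  toC c * (toC (W v u) * x u * (z u - z v) + toC (W v v) * x v * (z v - z v) + (Q - S * z v))
  - (toC (W u u) * x u * (z u - z u) + toC (W u v) * x v * (z v - z u) + toC c * (Q - S * z u)).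
  by rewrite (Wsym v u) rmorphM; ring.
by rewrite eu ev; ring.
Qed.

Definition merged (i : V) : R[i] := if i == v then x v + toC c * x u else x i.

Lemma upper_merged : {in U :\ u, forall i, upper (merged i)}.
Proof.
move=> i; rewrite !inE => /andP [_ iU]; rewrite /merged; case: ifP => _; last exact: ux.
rewrite /upper ImD; apply: ltr_wpDr; last exact: ux.
by rewrite ge0_ImM // ux.
Qed.

(** As [z u = z v], the terms of [u] and [v] in a row share one difference, and proportionality
    collects their coefficients into that of [v]. *)
Lemma balanced_merged : balanced W (U :\ u) merged z.
Proof.
move=> i; rewrite !inE => /andP [iu iU].
have := bal iU; rewrite big_split_pair => e.
rewrite (bigD1 v) /=; last by rewrite !inE eq_sym uv.
rewrite (eq_bigl (mem B)); last by move=> k; rewrite !inE negb_or andbAC.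
have -> : \sum_(j in B) toC (W i j) * merged j * (z j - z i) =
          \sum_(j in B) toC (W i j) * x j * (z j - z i).
  apply: eq_bigr => j; rewrite /merged !inE negb_or => /andP [/andP [_ /negPf ->]] //.
rewrite /merged eqxx -[RHS]e; congr (_ + _).
rewrite twin_values; have [->|iv] := eqVneq i v; first by ring.
have -> : W i u = c * W i v.
  by rewrite !(Wsym i) prop // !inE negb_or iu iv.
by rewrite rmorphM; ring.
Qed.

End Step.

Lemma wconnected_rigid :
  (forall U, (2 < #|U|)%N -> exists u v, [/\ u \in U, v \in U, u != v &
     rank_one W [set u; v] (U :\: [set u; v])]) ->
  forall U, wconnected U -> rigid W U.
Proof.
move=> pairs U; have [n] := ubnP #|U|; elim: n U => // n IH U Un connU x z ux bal.
have [U1|U2] := leqP #|U| 1.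
  by move=> i j iU jU; rewrite (card_le1_eqP U1 i j iU jU).
have [u [v [uU vU uv ro]]] : exists u v, [/\ u \in U, v \in U, u != v &
     rank_one W [set u; v] (U :\: [set u; v])].
  have [U3|] := ltnP 2 #|U|; first exact: pairs.
  move=> U3; have /cards2P [u [v [uv ->]]] : #|U| == 2%N by rewrite eqn_leq U2 U3.
  exists u, v; rewrite set21 set22; split=> // i i' k k' _ _.
  by rewrite setDv inE.
(* One of the two rows is a multiple of the other. If the row of [v] vanishes on the rest of [U],
   the roles are exchanged and [c = 0]. *)
wlog [c c0 prop] : u v uU vU uv ro /
    exists2 c, 0 <= c & forall k, k \in U :\: [set u; v] -> W u k = c * W v k.
  move=> wl; have [/exists_inP [k0 k0B nz]|] := boolP [exists k in U :\: [set u; v], W v k != 0].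
    apply: (wl u v) => //; exists (W u k0 / W v k0); first by rewrite divr_ge0.
    move=> k kB; rewrite mulrAC (ro u v k0 k) ?set21 ?set22 //.
    by rewrite mulfK.
  rewrite negb_exists_in => /forall_inP vz.
  apply: (wl v u) => //; rewrite 1?eq_sym 1?setUC //; exists 0 => // k kB.
  by apply/eqP; rewrite mul0r; have := vz k kB; rewrite negbK.
have zuv := twin_values uU vU uv c0 prop connU ux bal.
have rec : {in U :\ u &, forall i j, z i = z j}.
  apply: (IH _ _ _ (merged u v c x)); last 1 first.
  - exact: balanced_merged.
  - by move: Un; rewrite (cardsD1 u) uU.
  - exact: wconnectedD1 prop connU.
  - exact: upper_merged.
have zv i : i \in U -> z i = z v.
  move=> iU; have [->//|iu] := eqVneq i u.
  by apply: rec; rewrite !inE ?iu // eq_sym uv.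
by move=> i j iU jU; rewrite !zv.
Qed.

End Merging.

Lemma connected_wconnected (R : realType) (V : finType) (E : {set {set V}}) (w : {set V} -> R) :
  connected_graph E -> (forall e, e \in E -> 0 < w e) -> wconnected (wadj E w) setT.
Proof.
move=> cE w0 A _ /set0Pn [a aA] AnT.
apply: contrapT => no.
case/eqP: AnT; apply/eqP; rewrite eqEsubset subsetT; apply/subsetP => b _.
apply: (@connect_preserves _ (adj E) (fun k => k \in A) a b) => // i j iA ij.
apply: contraT => jA; case: no; exists i, j; rewrite !inE jA iA; split=> //.
by rewrite /wadj; move: ij; rewrite /adj /= => ij; rewrite ij gt_eqF ?w0.
Qed.

Lemma wadj_ge0 (R : realType) (V : finType) (E : {set {set V}}) (w : {set V} -> R) i j :
  (forall e, e \in E -> 0 < w e) -> 0 <= wadj E w i j.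
Proof. by move=> w0; rewrite /wadj; case: ifP => // /w0 /ltW. Qed.

Lemma width_one_rigid (R : realType) (V : finType) (E : {set {set V}}) (w : {set V} -> R)
    (T : leaf_tree V) :
  connected_graph E -> (forall e, e \in E -> 0 < w e) ->
  (tree_width E w T <= 1)%N -> rigid (wadj E w) setT.
Proof.
move=> cE w0 /bigmax_leqP tw.
apply: wconnected_rigid; last exact: connected_wconnected.
- exact: wadjC.
- by move=> i j; exact: wadj_ge0.
move=> U U3; have [e [a [eF ae /eqP/cards2P [u [v [uv suv]]]]]] := side_meets_twice T U3.
have ro : rank_one (wadj E w) (side e a) (~: side e a).
  apply: rank_oneC; first exact: wadjC.
  by apply/cut_rank_le1P; have /bigmax_leqP := tw e eF; apply.
have sub k : k \in [set u; v] -> (k \in side e a) && (k \in U) by rewrite -suv inE.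
have /andP [_ uU] := sub u (set21 _ _); have /andP [_ vU] := sub v (set22 _ _).
exists u, v; split=> //; apply: rank_oneS ro.
  by apply/subsetP => k /sub /andP [].
apply/subsetP => k; rewrite -suv in_setD in_setI in_setC => /andP [+ kU].
by rewrite kU andbT.
Qed.

(** * The resolvent *)

Section Resolvent.
Variables (R : realType) (V : finType) (W : V -> V -> R).
Hypotheses (Wsym : forall i j, W i j = W j i) (Wge0 : forall i j, 0 <= W i j).
Hypothesis Wconn : wconnected W setT.
Implicit Types (A : {set V}) (i j k l : V).
Local Notation toC := (real_complex R).

(** An explicit value of [t]: it exceeds every row sum, which makes [t - W] strictly diagonally
    dominant. *)
Definition shift : R := 1 + \sum_i \sum_j W i j.

Lemma row_sum_lt i (P : pred V) : \sum_(j | P j) W i j < shift.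
Proof.
apply: (@le_lt_trans _ _ (\sum_i \sum_j W i j)); last by rewrite /shift ltrDr.
rewrite [leRHS](bigD1 i) //= -[leLHS]addr0; apply: lerD.
  by rewrite [leRHS](bigID P) /= lerDl sumr_ge0.
by apply: sumr_ge0 => k _; apply: sumr_ge0.
Qed.

(** Compare both sides at an entry of largest absolute value. Stated for principal blocks, since
    injectivity of blocks of the resolvent rests on it. *)
Lemma diag_dominant_eq0 A (y : V -> R) :
  {in A, forall i, shift * y i = \sum_(j in A) W i j * y j} -> {in A, forall i, y i = 0}.
Proof.
move=> ey i0 i0A.
case: (@arg_maxP _ _ _ i0 (mem A) (fun i => `|y i|) i0A) => i iA imax.
have : shift * `|y i| <= (\sum_(j in A) W i j) * `|y i|.
  have b0 : 0 <= shift by rewrite addr_ge0 // sumr_ge0 // => k _; exact: sumr_ge0.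
  rewrite -{1}(ger0_norm b0) -normrM ey // mulr_suml.
  apply: le_trans (ler_norm_sum _ _ _) _; apply: ler_sum => j jA.
  by rewrite normrM ger0_norm // ler_wpM2l //; exact: imax.
rewrite -subr_ge0 -mulrBl => h.
have yi : `|y i| = 0.
  apply/eqP; rewrite eq_le normr_ge0 andbT leNgt; apply/negP => y0.
  by move: h; rewrite pmulr_lge0 // subr_ge0 leNgt row_sum_lt.
by apply/eqP; rewrite -normr_le0 -yi; exact: imax.
Qed.

Let K i j : R := shift * (i == j)%:R - W i j.

Let Kmx : 'M[R]_#|V| := \matrix_(i, j) K (enum_val i) (enum_val j).

Lemma shifted_sym i j : K i j = K j i.
Proof. by rewrite /K Wsym eq_sym. Qed.

Lemma sum_shifted (y : V -> R) i : \sum_j K i j * y j = shift * y i - \sum_j W i j * y j.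
Proof.
under eq_bigr do rewrite mulrBl -mulrA.
by rewrite sumrB -mulr_sumr sum_delta.
Qed.

Lemma Kmx_unit : Kmx \in unitmx.
Proof.
rewrite unitmxE unitfE -/(fdet K); apply/fdet0P => -[y [v yv] ey].
case/eqP: yv; apply: (@diag_dominant_eq0 setT y) => // i _.
apply/eqP; rewrite -subr_eq0; apply/eqP; rewrite -[RHS](ey i) sum_shifted; congr (_ - _).
by apply: eq_bigl => j; rewrite inE.
Qed.

Definition resolvent i j : R := invmx Kmx (enum_rank i) (enum_rank j).
Local Notation N := resolvent.

Lemma resolventC i j : N i j = N j i.
Proof.
have KT : Kmx^T = Kmx by apply/matrixP => a b; rewrite !mxE shifted_sym.
by rewrite /N -{1}KT -trmx_inv mxE.
Qed.

Lemma mul_shifted_resolvent i j : \sum_k K i k * N k j = (i == j)%:R.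
Proof.
have /matrixP /(_ (enum_rank i) (enum_rank j)) := mulmxV Kmx_unit.
rewrite !mxE (inj_eq enum_rank_inj) => <-.
rewrite (reindex (@enum_val V predT)) /=; last exact: onW_bij (enum_val_bij V).
by apply: eq_bigr => k _; rewrite !mxE /N enum_rankK enum_valK.
Qed.

Lemma mul_resolvent i j : \sum_k W i k * N k j = shift * N i j - (i == j)%:R.
Proof. by rewrite -mul_shifted_resolvent sum_shifted; ring. Qed.

(** Minimum principle: at the least entry of column [j], the nonnegative entry of [K N] is at most
    that least entry times the positive gap [shift - \sum_l W k l]. *)
Lemma resolvent_ge0 i j : 0 <= N i j.
Proof.
case: (@arg_minP _ _ _ i predT (fun k => N k j) isT) => k _ kmin.
apply: le_trans (kmin i isT).
have : 0 <= (shift - \sum_l W k l) * N k j.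
  apply: (@le_trans _ _ (k == j)%:R); first exact: ler0n.
  rewrite -(mul_shifted_resolvent k j) sum_shifted mulrBl lerB // mulr_suml; apply: ler_sum => l _.
  by rewrite ler_wpM2l //; exact: kmin.
by rewrite pmulr_rge0 // subr_gt0 row_sum_lt.
Qed.

(** At a zero of column [j], the identity [W N = shift N - 1] shows that the row index is not [j]
    and has no neighbour in the support. By connectivity the support is everything. *)
Lemma resolvent_gt0 i j : 0 < N i j.
Proof.
rewrite lt_neqAle resolvent_ge0 andbT eq_sym.
pose A := [set k | N k j != 0].
suff AT : A = setT by move: (in_setT i); rewrite -AT inE.
have zero k : k \notin A -> (k != j) /\ forall l, l \in A -> W k l = 0.
  rewrite inE negbK => /eqP Nk.
  have := mul_resolvent k j; rewrite Nk mulr0 sub0r => e.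
  have nn l : true -> 0 <= W k l * N l j by move=> _; rewrite mulr_ge0 ?resolvent_ge0.
  have e0 : \sum_l W k l * N l j = 0.
    apply/eqP; rewrite eq_le sumr_ge0 // andbT e oppr_le0; exact: ler0n.
  split; first by move: e; rewrite e0; case: eqVneq => // _ /eqP; rewrite eq_sym oppr_eq0 oner_eq0.
  move=> l; rewrite inE => lA; have /eqP := psumr_eq0P nn e0 (i := l) isT.
  by rewrite mulf_eq0 (negPf lA) orbF => /eqP.
apply/eqP; apply: contraT => AnT.
have A0 : A != set0.
  by apply/set0Pn; exists j; apply: contraT => /zero []; rewrite eqxx.
have [i' [k [i'A kA ik]]] := Wconn (subsetT A) A0 AnT.
move: kA; rewrite in_setD in_setT andbT => /zero [_ /(_ _ i'A) Wk].
by rewrite Wsym Wk eqxx in ik.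
Qed.

(** Let [y = N d] with [d] extended by zero on [A]. Then [y] vanishes outside [A] and [K y = d]
    vanishes on [A], so [y] is in the kernel of the block of [K] on [A], which is diagonally
    dominant. *)
Lemma resolvent_inj A (d : V -> R) :
  {in ~: A, forall l, \sum_(k in ~: A) d k * N k l = 0} -> {in ~: A, forall k, d k = 0}.
Proof.
move=> ed; pose y l := \sum_(k in ~: A) d k * N k l.
have yK j : \sum_l K j l * y l = if j \in A then 0 else d j.
  rewrite /y; under eq_bigr do rewrite mulr_sumr.
  rewrite exchange_big /=.
  under eq_bigr => k _.
    under eq_bigr => l _ do rewrite (resolventC k) mulrCA.
    rewrite -mulr_sumr mul_shifted_resolvent; over.
  case: ifP => jA.
    rewrite big1 // => k; rewrite inE => kA; case: eqVneq => [jk|_]; last by rewrite mulr0.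
    by rewrite -jk jA in kA.
  rewrite (bigD1 j) ?inE ?jA //= eqxx mulr1 big1 ?addr0 // => k /andP [_ kj].
  by rewrite eq_sym (negPf kj) mulr0.
have yA : {in A, forall l, y l = 0}.
  apply: diag_dominant_eq0 => j jA.
  have /eqP := yK j; rewrite jA sum_shifted subr_eq0 => /eqP ->.
  rewrite [LHS](bigID (mem A)) /= [X in _ + X]big1 ?addr0 // => l lA.
  by rewrite /y ed ?mulr0 // inE.
move=> j; rewrite inE => jA; have := yK j; rewrite (negPf jA) => <-.
rewrite big1 // => l _; have [lA|lA] := boolP (l \in A); first by rewrite yA ?mulr0.
by rewrite /y ed ?mulr0 // inE.
Qed.

(* For i in A and l outside A, (K N)_il = 0 turns a factorisation N = g h off the diagonal blocks into one of K, since the block of N outside A is injective. *)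
Lemma rank_one_resolvent A : rank_one N A (~: A) -> rank_one W A (~: A).
Proof.
move=> ro i i' k k' iA i'A kA k'A.
pose g j := N j k; pose h l := N i l / N i k.
have Nik : N i k != 0 by rewrite gt_eqF ?resolvent_gt0.
have gh j l : j \in A -> l \in ~: A -> N j l = g j * h l.
  by move=> jA lA; rewrite /g /h mulrA (ro j i k l) // mulfK.
pose a j := \sum_(j' in A) K j j' * g j'.
have Kh j l : j \in A -> l \in ~: A -> \sum_(m in ~: A) K j m * N m l = - (a j * h l).
  move=> jA lA; apply/eqP; rewrite -addr_eq0; apply/eqP.
  have jl : j != l by apply: contraTneq lA => <-; rewrite inE jA.
  have := mul_shifted_resolvent j l; rewrite (negPf jl) => e0; rewrite -[RHS]e0.
  rewrite [RHS](bigID (mem A)) /= [LHS]addrC; congr (_ + _).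
    by rewrite /a mulr_suml; apply: eq_bigr => m mA; rewrite gh // mulrA.
  by apply: eq_bigl => m; rewrite inE.
have KW j m : j \in A -> m \in ~: A -> K j m = - W j m.
  move=> jA; rewrite inE => mA; rewrite /K; case: eqVneq => [jm|_].
    by rewrite -jm jA in mA.
  by rewrite mulr0 sub0r.
have zero j m : j \in A -> a j = 0 -> m \in ~: A -> W j m = 0.
  move=> jA aj mA; apply/eqP; rewrite -oppr_eq0 -KW //; apply/eqP.
  by apply: (@resolvent_inj A (K j)) => // l lA; rewrite Kh // aj mul0r oppr0.
have prop m : m \in ~: A -> a i' * W i m = a i * W i' m.
  move=> mA; apply/eqP; rewrite -subr_eq0 -oppr_eq0; apply/eqP.
  transitivity (a i' * K i m - a i * K i' m); first by rewrite !KW //; ring.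
  apply: (@resolvent_inj A (fun m => a i' * K i m - a i * K i' m)) => // l lA.
  under eq_bigr do rewrite mulrBl -!mulrA.
  by rewrite sumrB -!mulr_sumr !Kh //; ring.
have [ai|ai] := eqVneq (a i) 0; first by rewrite !(zero i) // !mul0r.
apply: (mulfI ai).
by rewrite mulrCA -prop // [RHS]mulrCA -prop //; ring.
Qed.

(** With [y = N x], balance for [N] says that [y z = N (x z)] entrywise. Applying
    [W N = shift N - 1] to [x z] and to [x], the row [W (y z) - z (W y)] cancels completely. *)
Lemma rigid_resolvent : rigid W setT -> rigid N setT.
Proof.
move=> rig x z ux /balanced_setT bal.
pose y i := \sum_j toC (N i j) * x j.
have yz i : y i * z i = \sum_j toC (N i j) * x j * z j.
  apply/eqP; rewrite -subr_eq0 -oppr_eq0; apply/eqP; rewrite -[RHS](bal i) opprB.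
  by rewrite mulr_suml -sumrB; apply: eq_bigr => j _; rewrite mulrBr.
have WNC i j : \sum_k toC (W i k) * toC (N k j) = toC shift * toC (N i j) - (i == j)%:R.
  rewrite -(rmorph_nat toC) -rmorphM -rmorphB -mul_resolvent rmorph_sum /=.
  by apply: eq_bigr => k _; rewrite rmorphM.
have sumW (s : V -> R[i]) i :
    \sum_j toC (W i j) * (\sum_k toC (N j k) * s k) =
    toC shift * (\sum_k toC (N i k) * s k) - s i.
  under eq_bigr do rewrite mulr_sumr.
  rewrite exchange_big /= -(sum_delta i s) mulr_sumr -sumrB; apply: eq_bigr => k _.
  under eq_bigr do rewrite mulrA.
  by rewrite -mulr_suml WNC mulrBl mulrA.
apply: (rig y) => [i _|].
  apply: (@upper_sum _ _ predT _ i) => // j _.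
  by apply: upperM; [exact: resolvent_gt0|exact: ux].
apply/balanced_setT => i.
transitivity (\sum_j toC (W i j) * (\sum_k toC (N j k) * (x k * z k))
              - (\sum_j toC (W i j) * y j) * z i).
  rewrite mulr_suml -sumrB; apply: eq_bigr => j _.
  have -> : \sum_k toC (N j k) * (x k * z k) = y j * z j.
    by rewrite yz; apply: eq_bigr => k _; rewrite mulrA.
  by ring.
rewrite !sumW -/(y i).
have -> : \sum_k toC (N i k) * (x k * z k) = y i * z i.
  by rewrite yz; apply: eq_bigr => k _; rewrite mulrA.
by ring.
Qed.

End Resolvent.

(** * Rigidity passes to subsets *)

Section PolynomialBounds.
Variable R : realType.
Local Notation toC := (real_complex R).

(** Factor [p] over its roots: each satisfies [|1 - u| <= |u| (1 + 1 / rho)]. The bound depends on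
    [p] only through its size and [p.[0]], and thus replaces a compactness argument. *)
Lemma poly_le_no_small_root (p : {poly R[i]}) (rho : R[i]) : 0 < rho ->
  (forall t, root p t -> rho <= `|t|) ->
  `|p.[1]| <= `|p.[0]| * (1 + rho^-1) ^+ size p.
Proof.
move=> rho0 noroot.
have [->|pn0] := eqVneq p 0; first by rewrite !horner0 normr0 mul0r.
have [s ps] := closed_field_poly_normal p.
have rootE t : root p t = (t \in s).
  by rewrite ps rootZ ?lead_coef_eq0 // root_prod_XsubC.
have hornE t : `|p.[t]| = `|lead_coef p| * \prod_(u <- s) `|t - u|.
  rewrite {1}ps hornerZ normrM horner_prod normr_prod; congr (_ * _).
  by apply: eq_bigr => u _; rewrite hornerXsubC.
have size_s : (size s <= size p)%N.
  by rewrite ps size_scale ?lead_coef_eq0 // size_prod_XsubC.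
have c1 : 1 <= 1 + rho^-1 by rewrite lerDl invr_ge0 ltW.
apply: (@le_trans _ _ (`|p.[0]| * (1 + rho^-1) ^+ size s)); last first.
  by rewrite ler_wpM2l // ler_weXn2l.
rewrite !hornE -mulrA ler_wpM2l //.
have -> : (1 + rho^-1) ^+ size s = \prod_(u <- s) (1 + rho^-1).
  by rewrite big_const_seq count_predT iter_mulr_1.
rewrite -big_split /=.
rewrite !big_seq; apply: ler_prod => u us; rewrite normr_ge0 /=.
have ru : rho <= `|u| by apply: noroot; rewrite rootE.
apply: le_trans (ler_normB _ _) _.
by rewrite normr1 sub0r normrN mulrDr mulr1 addrC lerD2l ler_pdivlMr // mul1r.
Qed.

Lemma normC_Re (y : R[i]) : `|y| = toC (complex.Re `|y|).
Proof. by rewrite normc_def. Qed.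

Lemma poly_bounded (p : {poly R[i]}) :
  exists2 S : R, 0 <= S & forall e : R, 0 <= e -> e <= 1 -> `|p.[toC e]| <= toC S.
Proof.
elim/poly_ind: p => [|p c [S S0 HS]].
  by exists 0 => // e _ _; rewrite horner0 normr0.
exists (S + complex.Re `|c|).
  by rewrite addr_ge0 // normc_def /= sqrtr_ge0.
move=> e e0 e1; rewrite hornerMXaddC rmorphD.
apply: le_trans (ler_normD _ _) _; apply: lerD => /=; last by rewrite -normC_Re.
rewrite normrM -[toC S]mulr1; apply: ler_pM => //; first exact: HS.
by rewrite ger0_norm ?lecR // ler0c.
Qed.

(** An elementary limit: [p.[e]] differs from [p.[0]] by at most a multiple of [e], and [q.[e]] is
    itself at most a multiple of [e]. *)
Lemma horner0_limit (p q : {poly R[i]}) (B : R[i]) : 0 <= B -> q.[0] = 0 ->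
  (forall e : R, 0 < e -> `|p.[toC e]| <= B * `|q.[toC e]|) -> p.[0] = 0.
Proof.
move=> B0 q0 le_pq.
have /factor_theorem [p1 p1E] : root (p - p.[0]%:P) 0.
  by rewrite /root hornerD hornerN hornerC subrr.
have /factor_theorem [q1 q1E] : root q 0 by rewrite /root q0.
have [S S0 HS] := poly_bounded p1; have [S' S'0 HS'] := poly_bounded q1.
have pE : p = p1 * ('X - 0%:P) + p.[0]%:P by rewrite -p1E subrK.
have BE : B = toC (complex.Re B) by rewrite -{1}(ger0_norm B0) normC_Re ger0_norm.
set b := complex.Re B in BE; pose m := complex.Re `|p.[0]|.
have b0 : 0 <= b by rewrite -ler0c -BE.
have m0 : 0 <= m by rewrite -ler0c -normC_Re.
have le_m e : 0 < e -> e <= 1 -> m <= e * (b * S' + S).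
  move=> e0 e1; rewrite -lecR -normC_Re.
  have -> : p.[0] = p.[toC e] - p1.[toC e] * toC e.
    by rewrite {2}pE subr0 hornerMXaddC addrC addKr.
  apply: le_trans (ler_normB _ _) _.
  have ne : `|toC e| = toC e by rewrite ger0_norm // ler0c ltW.
  rewrite mulrDr rmorphD; apply: lerD; last first.
    by rewrite normrM ne mulrC rmorphM ler_wpM2l ?ler0c ?HS // ltW.
  apply: le_trans (le_pq e e0) _.
  have -> : `|q.[toC e]| = `|q1.[toC e]| * toC e.
    by rewrite q1E hornerM hornerXsubC subr0 normrM ne.
  rewrite BE mulrA mulrC (rmorphM toC e) (rmorphM toC b) /=.
  by rewrite !ler_wpM2l ?ler0c ?HS' // ltW.
apply/eqP; rewrite -normr_eq0 normC_Re -/m; apply/eqP; congr toC.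
apply/eqP; rewrite eq_le m0 andbT leNgt; apply/negP => m1.
have M0 : 0 <= b * S' + S by rewrite addr_ge0 // mulr_ge0.
set M := b * S' + S in M0 le_m.
have Mm : 0 < M + m by exact: ltr_wpDl.
have := le_m (m / (M + m)); rewrite divr_gt0 // ler_pdivrMr // mul1r lerDr M0.
move=> /(_ isT isT); rewrite mulrAC ler_pdivlMr // ler_pM2l //.
by rewrite gerDl leNgt m1.
Qed.

End PolynomialBounds.

Section Heredity.
Variables (R : realType) (V : finType) (N : V -> V -> R).
Hypotheses (Nsym : forall i j, N i j = N j i) (Ngt0 : forall i j, 0 < N i j).
Implicit Types (U : {set V}) (x z : V -> R[i]).
Local Notation toC := (real_complex R).

Let D (r : V) x : R[i] := fdet (rooted_laplacian r (fun i j => toC (N i j) * x j)).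

(** With [x] zero off [U], the equation at an outside vertex just says that its value is the
    weighted average of [z] over [U]; the total weight is nonzero because it lies in the upper
    half-plane. *)
Lemma extend_balanced U x z (r s : V) : r \in U -> s \in U -> z s != z r ->
  {in U, forall i, upper (x i)} -> balanced N U x z ->
  D r (fun j => if j \in U then x j else 0) = 0.
Proof.
move=> rU sU zsr ux bal; apply/eqP/rooted_laplacian0P.
pose S i := \sum_(j in U) toC (N i j) * x j.
have Sup i : S i != 0.
  by apply: upper_neq0; apply: (@upper_sum _ _ _ _ r) => // j jU; apply: upperM (ux _ jU).
pose y i := if i \in U then z i else (\sum_(j in U) toC (N i j) * x j * z j) / S i.
exists y; first by exists s; rewrite /y rU sU.
move=> i _.
transitivity (\sum_(j in U) toC (N i j) * x j * (z j - y i)).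
  rewrite [LHS](bigID (mem U)) /= [X in _ + X]big1 ?addr0.
    by apply: eq_bigr => j jU; rewrite /y jU.
  by move=> j /negPf ->; rewrite mulr0 mul0r.
have [iU|iU] := boolP (i \in U).
  by rewrite -[RHS](bal i iU); apply: eq_bigr => j _; rewrite /y iU.
under eq_bigr do rewrite mulrBr.
by rewrite sumrB -mulr_suml -/(S i) /y (negPf iU) mulrC divfK // subrr.
Qed.

(** Maximum principle: at a vertex farthest from [z r], the difference to [z r] is a weighted
    average over [U] in which [r] has positive weight and distance zero. This supplies the point
    where the polynomial of the Hurwitz argument does not vanish. *)
Lemma ones_nonzero U (r : V) : r \in U -> D r (fun j => (j \in U)%:R) != 0.
Proof.
move=> rU; apply/rooted_laplacian0P => -[z [v vz] eqs].
pose h i := complex.Re `|z i - z r|.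
have hE i : `|z i - z r| = toC (h i) by rewrite normC_Re.
have sumN i (g : V -> R[i]) : \sum_j toC (N i j) * (j \in U)%:R * g j = \sum_(j in U) toC (N i j) * g j.
  rewrite [RHS]big_mkcond; apply: eq_bigr => j _.
  by case: ifP; rewrite ?mulr1 ?mulr0 ?mul0r.
case: (@arg_maxP _ _ _ v predT h isT) => i _ imax.
have hv : 0 < h v by rewrite -ltcR -hE normr_gt0 subr_eq0.
have hi : 0 < h i by apply: lt_le_trans hv (imax v isT).
have ir : i != r by apply: contraTneq hi => ->; rewrite /h subrr normr0 ltxx.
have := eqs i ir; rewrite sumN => e.
have : (\sum_(j in U) N i j) * h i <= \sum_(j in U) N i j * h j.
  rewrite -lecR rmorphM rmorph_sum /= -hE -[X in X * _]ger0_norm; last first.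
    by apply: sumr_ge0 => j _; rewrite ler0c ltW.
  rewrite -normrM mulr_suml.
  have -> : \sum_(j in U) toC (N i j) * (z i - z r) = \sum_(j in U) toC (N i j) * (z j - z r).
    apply/eqP; rewrite -subr_eq0 -oppr_eq0 -[X in _ == X]e opprB -sumrB; apply/eqP.
    by apply: eq_bigr => j _; ring.
  apply: le_trans (ler_norm_sum _ _ _) _; rewrite rmorph_sum; apply: ler_sum => j _ /=.
  by rewrite normrM hE rmorphM ger0_norm // ler0c ltW.
apply/negP; rewrite -ltNge mulr_suml (bigD1 r) //= [ltRHS](bigD1 r) //=.
apply: ltr_leD.
  by rewrite /h subrr normr0 mulr0 mulr_gt0.
by apply: ler_sum => j _; apply: ler_wpM2l; [exact: ltW|exact: imax].
Qed.

(* Hurwitz: as e -> 0+, the zero of t |-> D(x + t(1 - x) on U, i e off U) at t = 0 persists nearby. *)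
Lemma rigid_subset U : rigid N setT -> rigid N U.
Proof.
move=> rig x z ux bal s r sU rU; apply/eqP; apply: contraT => zsr.
have D0 := extend_balanced rU sU zsr ux bal.
have Dn x' : (forall i, upper (x' i)) -> D r x' != 0.
  by apply: (iffLR (rigid_setT_fdet r Nsym)).
(* The outer variable is [t], the inner one [e]. *)
pose X (j : V) : {poly {poly R[i]}} :=
  if j \in U then (x j)%:P%:P + 'X * (1 - x j)%:P%:P else (Complex 0 1 *: 'X)%:P.
pose F : {poly {poly R[i]}} := fdet (rooted_laplacian r (fun i j => (toC (N i j))%:P%:P * X j)).
pose pt (t e : R[i]) (j : V) := if j \in U then x j + t * (1 - x j) else Complex 0 1 * e.
have FE t e : F.[t%:P].[e] = D r (pt t e).
  rewrite -[F.[_]]/(horner_eval t%:P F) -[_.[e]]/(horner_eval e _) !fdet_map.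
  apply: eq_fdet => i j; rewrite !rooted_laplacian_map; apply: eq_rooted_laplacian => {}i k.
  by rewrite /= /horner_eval /X /pt; case: ifP => _; rewrite !hornerE.
have eqD x1 x2 : x1 =1 x2 -> D r x1 = D r x2.
  move=> x12; apply: eq_fdet => i j; apply: eq_rooted_laplacian => {}i k.
  by rewrite x12.
(* While [|t| < d j], the point [x j + t * (1 - x j)] stays in the upper half-plane; the added 1
   avoids division by zero. *)
pose d j := complex.Im (x j) / (1 + complex.Re `|1 - x j|).
have nn j : 0 < 1 + complex.Re `|1 - x j| by rewrite ltr_pwDl // -ler0c -normC_Re.
have d0 j : j \in U -> 0 < d j by move=> /ux; rewrite /upper => xj; rewrite divr_gt0.
(* A positive lower bound for all [d j], valid also without taking a minimum. *)
pose delta : R := (1 + \sum_(j in U) (d j)^-1)^-1.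
have delta0 : 0 < delta.
  by rewrite invr_gt0 ltr_pwDl // sumr_ge0 // => j jU; rewrite invr_ge0 ltW ?d0.
have delta_le j : j \in U -> delta <= d j.
  move=> jU; rewrite -[d j]invrK lef_pV2 ?posrE ?invr_gt0 ?d0 //; last by rewrite -invr_gt0.
  rewrite (bigD1 j) //= addrCA lerDl addr_ge0 // sumr_ge0 // => k /andP [kU _].
  by rewrite invr_ge0 ltW ?d0.
have noroot (e : R) t : 0 < e -> root (map_poly (horner_eval (toC e)) F) t -> toC delta <= `|t|.
  move=> e0 rt; rewrite normC_Re lecR leNgt; apply/negP => td.
  have : D r (pt t (toC e)) = 0.
    rewrite -FE; move/eqP: rt.
    by rewrite -{1}[t](hornerC t (toC e)) -[_.[toC e]]/(horner_eval (toC e) t%:P) horner_map.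
  apply/eqP/Dn => j; rewrite /pt; case: ifP => jU; last first.
    by rewrite /upper /= mulr0 mul1r add0r.
  have le_Im (y : R[i]) : - complex.Re `|y| <= complex.Im y.
    rewrite normc_def /=; case: y => a b /=; apply: lerNnormlW.
    by rewrite -sqrtr_sqr ler_sqrt ?addr_ge0 ?sqr_ge0 // lerDr sqr_ge0.
  rewrite /upper ImD -ltrBlDl sub0r; apply: lt_le_trans (le_Im _).
  rewrite ltrN2 -ltcR -normC_Re normrM normC_Re (normC_Re (1 - x j)) -rmorphM ltcR.
  apply: (@le_lt_trans _ _ (complex.Re `|t| * (1 + complex.Re `|1 - x j|))).
    by rewrite mulrDr mulr1 lerDr -ler0c -normC_Re.
  by rewrite -ltr_pdivlMr //; apply: lt_le_trans td (delta_le _ jU).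
pose B := (1 + (toC delta)^-1) ^+ size F.
have c1 : 1 <= 1 + (toC delta)^-1 by rewrite lerDl invr_ge0 ler0c ltW.
have B0 : 0 <= B by rewrite exprn_ge0 // (le_trans ler01 c1).
have := ones_nonzero rU.
have -> : D r (fun j => (j \in U)%:R) = F.[1%:P].[0].
  rewrite FE; apply: eqD => j; rewrite /pt; case: ifP => _; last by rewrite mulr0.
  by rewrite mul1r addrC subrK.
(* The constant [B] does not depend on [e]: specialising [e] cannot raise the size in [t]. The value
   at [t = 0], [e = 0] vanishes by [D0], so the one at [t = 1], [e = 0] would too. *)
case/eqP; apply: (horner0_limit (q := F.[0%:P]) B0).
  rewrite FE -[RHS]D0; apply: eqD => j; rewrite /pt; case: ifP => _; last by rewrite mulr0.
  by rewrite mul0r addr0.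
move=> e e0; have fE t : F.[t%:P].[toC e] = (map_poly (horner_eval (toC e)) F).[t].
  have {2}-> : t = horner_eval (toC e) t%:P by rewrite /horner_eval hornerC.
  by rewrite horner_map.
rewrite !fE mulrC.
apply: le_trans (poly_le_no_small_root _ (fun t => noroot e t e0)) _.
  by rewrite ltcR.
by rewrite ler_wpM2l // ler_weXn2l // size_poly.
Qed.

End Heredity.

(** * The four-point condition *)

Section FourVertices.
Variable R : realType.
Local Notation toC := (real_complex R).

(* The spanning tree polynomial of the complete graph on {1, 2, 3, 4} with weights w_12 = a, w_13 = b, w_23 = c and w_i4 = 1. *)
Definition k4_poly (K : comNzRingType) (a b c x1 x2 x3 x4 : K) : K :=
  a * b * x1 ^+ 2 + a * c * x2 ^+ 2 + b * c * x3 ^+ 2 + x4 ^+ 2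
  + a * (b + c) * x1 * x2 + b * (a + c) * x1 * x3 + c * (a + b) * x2 * x3
  + (a + b) * x1 * x4 + (a + c) * x2 * x4 + (b + c) * x3 * x4.

(* For distinct a, b, c this quadratic form has signature (2, 2): the vector v below is positive and orthogonal to the positive vector (1, 1, 1, 1). *)
Lemma k4_poly_zero (a b c : R) : 0 < a -> 0 < b -> 0 < c -> a != b -> b != c -> c != a ->
  exists x1 x2 x3 x4 : R[i], [/\ upper x1, upper x2, upper x3, upper x4 &
    k4_poly (toC a) (toC b) (toC c) x1 x2 x3 x4 = 0].
Proof.
move=> a0 b0 c0 nab nbc nca.
have [ab bc ca] : [/\ a - b != 0, b - c != 0 & c - a != 0] by rewrite !subr_eq0.
pose v1 := (a - b)^-1; pose v2 := (c - a)^-1; pose v3 := (b - c)^-1.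
pose g1 := 4 * a * b + a * c + b * c + a + b.
pose g2 := 4 * a * c + a * b + b * c + a + c.
pose g3 := 4 * b * c + a * b + a * c + b + c.
pose g4 := 2 * (1 + a + b + c).
have g40 : 0 < g4 by rewrite /g4; lra.
pose v4 := - (g1 * v1 + g2 * v2 + g3 * v3) / g4.
have orth : g1 * v1 + g2 * v2 + g3 * v3 + g4 * v4 = 0.
  by rewrite /v4; field; rewrite gt_eqF.
pose q1 := k4_poly a b c 1 1 1 1; pose qv := k4_poly a b c v1 v2 v3 v4.
have q10 : 0 < q1.
  by rewrite /q1 /k4_poly !expr1n !mulr1; do !apply: addr_gt0; rewrite ?mulr_gt0 ?addr_gt0.
have qv0 : 0 < qv.
  have -> : qv = (v4 + ((a + b) * v1 + (a + c) * v2 + (b + c) * v3) / 2) ^+ 2 + 3 / 4.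
    by rewrite /qv /k4_poly /v1 /v2 /v3; move: (v4) => y; field; rewrite ab bc ca.
  by apply: ltr_wpDl; [exact: sqr_ge0 | lra].
pose t := Num.sqrt (qv / q1).
have t2 : t ^+ 2 * q1 = qv by rewrite sqr_sqrtr ?divr_ge0 ?ltW // divfK // gt_eqF.
have t0 : 0 < t by rewrite sqrtr_gt0 divr_gt0.
pose I : R[i] := Complex 0 1.
have I2 : I ^+ 2 = -1 by exact: sqr_i.
have up (v : R) : upper (toC v + I * toC t).
  by rewrite /upper /= mul0r mul1r !add0r.
exists (toC v1 + I * toC t), (toC v2 + I * toC t), (toC v3 + I * toC t), (toC v4 + I * toC t).
split=> //.
have -> : k4_poly (toC a) (toC b) (toC c) (toC v1 + I * toC t) (toC v2 + I * toC t)
    (toC v3 + I * toC t) (toC v4 + I * toC t) =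
  toC qv + I * toC t * toC (g1 * v1 + g2 * v2 + g3 * v3 + g4 * v4) + I ^+ 2 * toC (t ^+ 2 * q1).
  rewrite /qv /q1 /k4_poly /g1 /g2 /g3 /g4.
  move: (v1) (v2) (v3) (v4) (t) (I) => u1 u2 u3 u4 s J; ring.
by rewrite orth t2 I2; ring.
Qed.

Section FourPoint.
Variables (V : finType) (N : V -> V -> R).
Hypotheses (Nsym : forall i j, N i j = N j i) (Ngt0 : forall i j, 0 < N i j).

Lemma four_point i1 i2 i3 i4 :
  uniq [:: i1; i2; i3; i4] -> rigid N [set i1; i2; i3; i4] ->
  [|| N i1 i2 * N i3 i4 == N i1 i3 * N i2 i4, N i1 i3 * N i2 i4 == N i1 i4 * N i2 i3 |
      N i1 i4 * N i2 i3 == N i1 i2 * N i3 i4].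
Proof.
move=> un rig; apply: contraT; rewrite !negb_or => /and3P [ab bc ca].
have n0 i j : N i j != 0 by rewrite gt_eqF.
pose a := N i1 i2 / (N i1 i4 * N i2 i4).
pose b := N i1 i3 / (N i1 i4 * N i3 i4).
pose c := N i2 i3 / (N i2 i4 * N i3 i4).
have [||||||x1 [x2 [x3 [x4 [u1 u2 u3 u4 q0]]]]] := @k4_poly_zero a b c.
- by rewrite divr_gt0 ?mulr_gt0.
- by rewrite divr_gt0 ?mulr_gt0.
- by rewrite divr_gt0 ?mulr_gt0.
- apply: contraNneq ab => ab; apply/eqP.
  have -> : N i1 i2 = a * (N i1 i4 * N i2 i4) by rewrite divfK ?mulf_neq0.
  have -> : N i1 i3 = b * (N i1 i4 * N i3 i4) by rewrite divfK ?mulf_neq0.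
  by rewrite ab; ring.
- apply: contraNneq bc => bc; apply/eqP.
  have -> : N i1 i3 = b * (N i1 i4 * N i3 i4) by rewrite divfK ?mulf_neq0.
  have -> : N i2 i3 = c * (N i2 i4 * N i3 i4) by rewrite divfK ?mulf_neq0.
  by rewrite bc; ring.
- apply: contraNneq ca => ca; apply/eqP.
  have -> : N i1 i2 = a * (N i1 i4 * N i2 i4) by rewrite divfK ?mulf_neq0.
  have -> : N i2 i3 = c * (N i2 i4 * N i3 i4) by rewrite divfK ?mulf_neq0.
  by rewrite ca; ring.
pose A := toC a; pose B := toC b; pose C := toC c.
pose z1 := A * x2 * (C * x3) + B * x3 * (A * x1 + C * x3 + x4).
pose z2 := B * x3 * (A * x1) + (A * x2 + B * x3 + x4) * (C * x3).
pose z3 := (A * x2 + B * x3 + x4) * (A * x1 + C * x3 + x4) - A ^+ 2 * x1 * x2.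
pose x i := if i == i1 then x1 / toC (N i1 i4) else if i == i2 then x2 / toC (N i2 i4)
            else if i == i3 then x3 / toC (N i3 i4) else x4.
pose z i := if i == i1 then z1 else if i == i2 then z2 else if i == i3 then z3 else 0.
move: (un); rewrite /= !inE !negb_or => /and4P [/and3P [n12 n13 n14] /andP [n23 n24] n34 _].
have [x1E z1E] : x i1 = x1 / toC (N i1 i4) /\ z i1 = z1 by rewrite /x /z eqxx.
have [x2E z2E] : x i2 = x2 / toC (N i2 i4) /\ z i2 = z2.
  by rewrite /x /z eq_sym (negPf n12) eqxx.
have [x3E z3E] : x i3 = x3 / toC (N i3 i4) /\ z i3 = z3.
  by rewrite /x /z !(eq_sym i3) (negPf n13) (negPf n23) eqxx.
have [x4E z4E] : x i4 = x4 /\ z i4 = 0.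
  by rewrite /x /z !(eq_sym i4) (negPf n14) (negPf n24) (negPf n34).
have ninC (i j : V) : toC (N i j) != 0 by rewrite fmorph_eq0.
have upd (i j : V) y : upper y -> upper (y / toC (N i j)).
  by move=> uy; rewrite mulrC -fmorphV upperM // invr_gt0.
have /eqP : z i1 = z i4.
  apply: (rig x); [move=> i|move=> i iU|by rewrite !inE eqxx|by rewrite !inE eqxx !orbT].
    by rewrite !inE -!orbA => /or4P [] /eqP ->; rewrite ?x1E ?x2E ?x3E ?x4E ?upd.
  have sum4 (g : V -> R[i]) : \sum_(j in [set i1; i2; i3; i4]) g j = g i1 + g i2 + g i3 + g i4.
    rewrite setUC big_setU1; last by rewrite !inE !(eq_sym i4) !negb_or n14 n24.
    rewrite setUC big_setU1; last by rewrite !inE !(eq_sym i3) !negb_or n13.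
    rewrite setUC big_setU1 ?big_set1; last by rewrite !inE eq_sym.
    by rewrite /=; ring.
  rewrite sum4 x1E x2E x3E x4E z1E z2E z3E z4E.
  have N12 : toC (N i1 i2) = A * (toC (N i1 i4) * toC (N i2 i4)).
    by rewrite /A -!rmorphM /a divfK ?mulf_neq0.
  have N13 : toC (N i1 i3) = B * (toC (N i1 i4) * toC (N i3 i4)).
    by rewrite /B -!rmorphM /b divfK ?mulf_neq0.
  have N23 : toC (N i2 i3) = C * (toC (N i2 i4) * toC (N i3 i4)).
    by rewrite /C -!rmorphM /c divfK ?mulf_neq0.
  move: iU; rewrite !inE -!orbA => /or4P [] /eqP ->.
  - rewrite z1E N12 N13.
    by rewrite /z1 /z2 /z3; field; rewrite !ninC.
  - rewrite z2E (Nsym i2 i1) N12 N23.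
    by rewrite /z1 /z2 /z3; field; rewrite !ninC.
  - rewrite z3E (Nsym i3 i1) (Nsym i3 i2) N13 N23.
    transitivity (- toC (N i3 i4) * x4 * k4_poly A B C x1 x2 x3 x4); last by rewrite q0 mulr0.
    by rewrite /z1 /z2 /z3 /k4_poly; field; rewrite !ninC.
  - rewrite z4E !(Nsym i4).
    transitivity (x3 * k4_poly A B C x1 x2 x3 x4); last by rewrite q0 mulr0.
    by rewrite /z1 /z2 /z3 /k4_poly; field; rewrite !ninC.
rewrite z1E z4E => /eqP z10; suff : upper (z1 / x3) by move/upper_neq0; rewrite z10 mul0r eqxx.
have x30 := upper_neq0 u3.
have -> : z1 / x3 = A * (C * x2) + A * (B * x1) + B * (C * x3) + B * x4.
  by rewrite /z1; field.
have ap : 0 < a by rewrite divr_gt0 ?mulr_gt0.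
have bp : 0 < b by rewrite divr_gt0 ?mulr_gt0.
have cp : 0 < c by rewrite divr_gt0 ?mulr_gt0.
by rewrite !upperD // !upperM.
Qed.

End FourPoint.
End FourVertices.

(** * Twins *)

Section Twins.
Variables (R : realType) (V : finType) (N : V -> V -> R).
Hypotheses (Nsym : forall i j, N i j = N j i) (Ngt0 : forall i j, 0 < N i j).
Hypothesis fourpt : forall i1 i2 i3 i4, uniq [:: i1; i2; i3; i4] ->
  [|| N i1 i2 * N i3 i4 == N i1 i3 * N i2 i4, N i1 i3 * N i2 i4 == N i1 i4 * N i2 i3 |
      N i1 i4 * N i2 i3 == N i1 i2 * N i3 i4].
Implicit Types (U X : {set V}).

Definition twins U i j : Prop :=
  forall k l, k \in U :\: [set i; j] -> l \in U :\: [set i; j] -> N i k * N j l = N i l * N j k.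

Let N0 i j : N i j != 0. Proof. by rewrite gt_eqF. Qed.

Lemma cross_weight (m sp sp' px py p'x p'y sx sy xy : R) :
  0 < m -> 0 < sp -> 0 < sp' -> 0 < px -> 0 < py -> 0 < p'x ->
  px * p'y = py * p'x -> sx * m = sp * p'x -> sy * m = sp' * py -> sp * p'x != sp' * px ->
  [|| sp * xy == sx * py, sx * py == sy * px | sy * px == sp * xy] ->
  [|| sp' * xy == sx * p'y, sx * p'y == sy * p'x | sy * p'x == sp' * xy] ->
  xy * m = px * p'y.
Proof.
move=> m0 sp0 sp'0 px0 py0 p'x0 tw sxm sym ne f1 f2.
pose rho := p'x / px.
have rho0 : 0 < rho by exact: divr_gt0.
have p'xE : p'x = rho * px by rewrite divfK ?gt_eqF.
have p'yE : p'y = rho * py.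
  by apply: (mulfI (lt0r_neq0 px0)); rewrite tw p'xE; ring.
have sxE : sx = sp * (rho * px) / m by rewrite -p'xE -sxm mulfK ?gt_eqF.
have syE : sy = sp' * py / m by rewrite -sym mulfK ?gt_eqF.
have mE (u v : R) : u == v -> u * m = v * m by move/eqP->.
have ne' : sp * rho != sp' by apply: contraNneq ne => <-; rewrite p'xE; apply/eqP; ring.
have pxy : px * py != 0 by rewrite mulf_neq0 ?gt_eqF.
have no (u : R) : u * (px * py) = 0 -> u = 0.
  by move/eqP; rewrite mulf_eq0 (negPf pxy) orbF => /eqP.
have spn := lt0r_neq0 sp0; have sp'n := lt0r_neq0 sp'0.
have sxm' : sx * m = sp * rho * px by rewrite sxm p'xE mulrA.
have nsxy : sx * py <> sy * px.
  move=> e; case/eqP: ne'; apply/eqP; rewrite -subr_eq0; apply/eqP; apply: no.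
  transitivity (sx * m * py - sy * m * px); first by rewrite sxm' sym; ring.
  by rewrite mulrAC e; ring.
rewrite p'yE; case/or3P: f1 => /eqP e1; [|by case: nsxy|].
  apply: (mulfI spn); transitivity (sx * m * py); first by rewrite mulrA e1; ring.
  by rewrite sxm'; ring.
case/or3P: f2 => /eqP e2.
- have e1' : sp * xy * m = sp' * (px * py) by rewrite -e1 mulrAC sym; ring.
  have e2' : sp' * xy * m = sp * rho ^+ 2 * (px * py).
    by rewrite e2 p'yE mulrAC sxm'; ring.
  have : (sp' - sp * rho) * (sp' + sp * rho) = 0.
    apply: no; transitivity (sp' * (sp' * (px * py)) - sp * (sp * rho ^+ 2 * (px * py))); first by ring.
    by rewrite -e1' -e2'; ring.
  have pos : 0 < sp' + sp * rho by apply: addr_gt0 => //; exact: mulr_gt0.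
  by move/eqP; rewrite mulf_eq0 subr_eq0 (gt_eqF pos) orbF eq_sym (negPf ne').
- case: nsxy; apply: (mulfI (lt0r_neq0 rho0)).
  by transitivity (sx * p'y); [rewrite p'yE; ring|rewrite e2 p'xE; ring].
- apply: (mulfI sp'n); transitivity (sp' * xy * m); first by ring.
  by rewrite -e2 p'xE mulrAC sym; ring.
Qed.

Lemma exists_twins U q : (2 < #|U|)%N -> q \in U ->
  exists i j, [/\ i \in U, j \in U, i != j, i != q /\ j != q & twins U i j].
Proof.
have [n] := ubnP #|U|; elim: n U q => // n IH U q Un U3 qU.
have [U4|U4] := leqP #|U| 3.
  have : #|U :\ q| == 2%N by rewrite -eqSS -[_.+1]/(true + _)%N -qU -cardsD1 eqn_leq U3 U4.
  case/cards2P => i [j [ij Uq]].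
  have [/andP [iq iU] /andP [jq jU]] : (i != q) && (i \in U) /\ (j != q) && (j \in U).
    by rewrite -!in_setD1 Uq set21 set22.
  exists i, j; split=> // k l.
  have one m : m \in U :\: [set i; j] -> m = q.
    rewrite in_setD => /andP [mij mU]; apply/eqP; apply: contraNT mij => mq.
    by rewrite -Uq in_setD1 mq.
  by move=> /one -> /one ->.
have [s] : exists s, s \in U :\ q.
  by apply/card_gt0P; have := cardsD1 q U; rewrite qU; lia.
rewrite in_setD1 => /andP [sq sU].
have Us : #|U :\ s|.+1 = #|U| by rewrite (cardsD1 s U) sU.
have [|||p [p' [pU p'U pp' [pq p'q] tw]]] := IH (U :\ s) q; rewrite ?in_setD1 ?(eq_sym q) ?sq //; try lia.
move: pU p'U; rewrite !in_setD1 => /andP [ps pU] /andP [p's p'U].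
have block (X : {set V}) (g h : V -> R) : X \subset U -> q \notin X -> (1 < #|X|)%N ->
    (#|X|.+1 < #|U|)%N -> (forall k, g k != 0) -> (forall k, h k != 0) ->
    (forall x k, x \in X -> k \in U -> k \notin X -> N x k = g x * h k) ->
    exists i j, [/\ i \in U, j \in U, i != j, i != q /\ j != q & twins U i j].
  move=> /subsetP XU qX X2 XltU g0 h0 fact.
  have cq : #|q |: X| = #|X|.+1 by rewrite cardsU1 qX.
  have [|||i [j [iX jX ij [iq jq] twij]]] := IH (q |: X) q; rewrite ?cq ?set11 ?in_setU1 ?eqxx //; first exact: leq_trans XltU Un.
  move: iX jX; rewrite !in_setU1 (negPf iq) (negPf jq) /= => iX jX.
  exists i, j; split; rewrite ?XU //.
  have T k : k \in U :\: [set i; j] -> N i k * g j = g i * N j k.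
    rewrite in_setD => /andP [kij kU].
    have [kX|kX] := boolP (k \in X); last by rewrite !fact //; ring.
    have kX' : k \in (q |: X) :\: [set i; j] by rewrite in_setD kij in_setU1 kX orbT.
    have qX' : q \in (q |: X) :\: [set i; j].
      by rewrite in_setD setU11 andbT !inE !(eq_sym q) negb_or iq jq.
    have := twij k q kX' qX'; rewrite !(fact _ q) // => e.
    by apply: (mulIf (h0 q)); rewrite -mulrA e; ring.
  move=> k l kU lU; apply: (mulIf (g0 j)); rewrite mulrAC T // -mulrA -(mulrCA (N j k)).
  apply: (mulIf (g0 j)).
  have := T l lU => e; transitivity (N j k * (g i * N j l) * g j); first by ring.
  by rewrite -e; ring.
pose Z := (U :\: [set p; p']) :\ s.
have ZP x : x \in Z -> [/\ x != s, x != p, x != p' & x \in U].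
  by rewrite !inE negb_or => /and3P [? /andP [? ?] ?].
have ZU x : x \in U -> x != s -> x != p -> x != p' -> x \in Z.
  by rewrite !inE negb_or => -> -> -> ->.
have tw' x y : x \in Z -> y \in Z -> N p x * N p' y = N p y * N p' x.
  move=> /ZP [xs xp xp' xU] /ZP [ys yp yp' yU].
  by apply: tw; rewrite !inE negb_or ?xs ?xp ?xp' ?ys ?yp ?yp'.
have qZ : q \in Z by rewrite ZU // eq_sym.
have [twU|ne] := pselect (forall x, x \in Z -> N s p * N p' x = N s p' * N p x).
  exists p, p'; split=> // k l; rewrite !in_setD !inE !negb_or.
  move=> /andP [/andP [kp kp'] kU] /andP [/andP [lp lp'] lU].
  have [->|ks] := eqVneq k s; have [->|ls] := eqVneq l s => //.
  - by rewrite !(Nsym _ s) twU ?ZU // mulrC.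
  - by rewrite !(Nsym _ s) [RHS]mulrC -[LHS]mulrC -twU ?ZU // mulrC.
  - by apply: tw'; rewrite ZU.
have {}ne x : x \in Z -> N s p * N p' x != N s p' * N p x.
  move=> xZ; apply/eqP => ex; case: ne => y yZ.
  apply: (mulfI (N0 p x)); rewrite mulrCA tw' // mulrCA [N p y * _]mulrC mulrA ex.
  by ring.
pose inX x := N s x * N p p' == N s p * N p' x.
have inY x : x \in Z -> ~~ inX x -> N s x * N p p' = N s p' * N p x.
  move=> xZ; have [xs xp xp' xU] := ZP x xZ.
  have : uniq [:: s; p; p'; x].
    by rewrite /= !inE !negb_or !(eq_sym s) ps p's xs pp' !(eq_sym _ x) xp xp'.
  by move/fourpt; rewrite (negPf (ne x xZ)) /= => /orP [/eqP ->|]; rewrite // /inX => ->.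
pose X := [set x in Z | inX x]; pose Y := [set x in Z | ~~ inX x].
have memX x : x \in X = (x \in Z) && inX x by rewrite in_set.
have memY x : x \in Y = (x \in Z) && ~~ inX x by rewrite in_set.
have XP x : x \in X -> x \in Z /\ N s x * N p p' = N s p * N p' x.
  by rewrite memX => /andP [-> /eqP].
have YP x : x \in Y -> x \in Z /\ N s x * N p p' = N s p' * N p x.
  by rewrite memY => /andP [xZ /(inY x xZ)].
have XorY x : x \in Z -> (x \in X) || (x \in Y).
  by move=> xZ; rewrite memX memY xZ /= orbN.
have cross x y : x \in X -> y \in Y -> N x y * N p p' = N p x * N p' y.
  move=> xX yY; have [xZ ex] := XP x xX; have [yZ ey] := YP y yY.
  have [xs xp xp' xU] := ZP x xZ; have [ys yp yp' yU] := ZP y yZ.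
  have xy : x != y.
    by apply: contraTneq xX => ->; move: yY; rewrite memX memY yZ.
  have un a : a != s -> x != a -> y != a -> uniq [:: s; a; x; y].
    by move=> as' xa ya; rewrite /= !inE !negb_or !(eq_sym s) as' xs ys !(eq_sym a) xa ya xy.
  exact: cross_weight (Ngt0 p p') (Ngt0 s p) (Ngt0 s p') (Ngt0 p x) (Ngt0 p y) (Ngt0 p' x)
    (tw' _ _ xZ yZ) ex ey (ne x xZ) (fourpt (un p ps xp yp)) (fourpt (un p' p's xp' yp')).
have m0 := N0 p p'.
have small (A : {set V}) a b : A \subset U -> a \in U -> b \in U -> a != b ->
    a \notin A -> b \notin A -> (#|A|.+1 < #|U|)%N.
  move=> AU aU bU ab aA bA.
  have -> : #|A|.+2 = #|a |: (b |: A)|.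
    by rewrite !cardsU1 !inE negb_or ab aA bA !add1n.
  by apply: subset_leq_card; rewrite !subUset !sub1set aU bU.
have XU : X \subset U by apply/subsetP => x /XP [/ZP []].
have YU : Y \subset U by apply/subsetP => x /YP [/ZP []].
have notX a : (a == s) || (a == p) || (a == p') -> a \notin X.
  by apply: contraTN => /XP [/ZP [/negPf -> /negPf -> /negPf ->]].
have notY a : (a == s) || (a == p) || (a == p') -> a \notin Y.
  by apply: contraTN => /YP [/ZP [/negPf -> /negPf -> /negPf ->]].
have [Y0|[y0 y0Y]] := set_0Vmem Y.
  exists s, p'; split; rewrite // 1?eq_sym //.
  have T k : k \in U :\: [set s; p'] -> N s k * N p p' = N s p * N p' k.
    rewrite !inE negb_or => /andP [/andP [ks kp'] kU].
    have [->|kp] := eqVneq k p; first by rewrite (Nsym p' p).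
    by have := XorY k (ZU k kU ks kp kp'); rewrite Y0 in_set0 orbF => /XP [].
  move=> k l kU lU; apply: (mulIf m0); rewrite mulrAC T // [RHS]mulrAC T //; ring.
have [X0|[x0 x0X]] := set_0Vmem X.
  exists s, p; split; rewrite // 1?eq_sym //.
  have T k : k \in U :\: [set s; p] -> N s k * N p p' = N s p' * N p k.
    rewrite !inE negb_or => /andP [/andP [ks kp] kU].
    have [->|kp'] := eqVneq k p'; first by [].
    by have := XorY k (ZU k kU ks kp kp'); rewrite X0 in_set0 => /YP [].
  move=> k l kU lU; apply: (mulIf m0); rewrite mulrAC T // [RHS]mulrAC T //; ring.
case/orP: (XorY q qZ) => [qX|qY].
  have qY : q \notin Y by move: qX; rewrite memX memY qZ /= negbK.
  apply: (block (p' |: Y) (N p) (fun k => N p' k / N p p')).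
  - by rewrite subUset sub1set p'U.
  - by rewrite in_setU1 negb_or eq_sym p'q.
  - by rewrite cardsU1 notY ?eqxx ?orbT // (cardsD1 y0) y0Y.
  - apply: (small _ s p) => //; rewrite ?subUset ?sub1set ?p'U 1?eq_sym // in_setU1 negb_or.
      by rewrite eq_sym p's notY ?eqxx.
    by rewrite pp' notY ?eqxx ?orbT.
  - by [].
  - by move=> k; rewrite mulf_neq0 ?invr_eq0.
  move=> y k yY kU; rewrite in_setU1 negb_or => /andP [kp' kY].
  apply: (mulIf m0); rewrite mulrA divfK //.
  move: yY; rewrite in_setU1 => /orP [/eqP ->|yY]; first by rewrite mulrC.
  have [yZ ey] := YP y yY.
  have [->|ks] := eqVneq k s; first by rewrite (Nsym y) ey mulrC (Nsym s).
  have [->|kp] := eqVneq k p; first by rewrite (Nsym y) (Nsym p' p).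
  have := XorY k (ZU k kU ks kp kp'); rewrite (negPf kY) orbF => kX.
  by rewrite (Nsym y) cross // tw' //; case: (XP k kX).
have qX : q \notin X by move: qY; rewrite memX memY qZ.
apply: (block (p |: X) (N p') (fun k => N p k / N p p')).
- by rewrite subUset sub1set pU.
- by rewrite in_setU1 negb_or eq_sym pq.
- by rewrite cardsU1 notX ?eqxx ?orbT // (cardsD1 x0) x0X.
- apply: (small _ s p') => //; rewrite ?subUset ?sub1set ?pU 1?eq_sym // in_setU1 negb_or.
    by rewrite eq_sym ps notX ?eqxx.
  by rewrite eq_sym pp' notX ?eqxx ?orbT.
- by [].
- by move=> k; rewrite mulf_neq0 ?invr_eq0.
move=> x k xX kU; rewrite in_setU1 negb_or => /andP [kp kX].
apply: (mulIf m0); rewrite mulrA divfK //.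
move: xX; rewrite in_setU1 => /orP [/eqP ->|xX]; first by rewrite mulrC (Nsym p' p).
have [xZ ex] := XP x xX.
have [->|ks] := eqVneq k s; first by rewrite (Nsym x) ex mulrC (Nsym s).
have [->|kp'] := eqVneq k p'; first by rewrite (Nsym x).
have := XorY k (ZU k kU ks kp kp'); rewrite (negPf kX) /= => kY.
by rewrite cross // tw' // 1?mulrC //; case: (YP k kY).
Qed.

End Twins.

(** * Trees from parent functions *)

Section ParentTrees.
Variables (T : finType) (r : T) (f : T -> T).
Hypothesis rf : rooted r f.
Implicit Types x y : T.

Definition parent_deg x : nat := (#|[set y | (y != r) && (f y == x)]| + (x != r))%N.

Lemma deg_parent_edges x : deg (parent_edges r f) x = parent_deg x.
Proof.
rewrite /deg.
have -> : [set e in parent_edges r f | x \in e] =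
          (fun y => [set y; f y]) @: [set y | (y != r) && (x \in [set y; f y])].
  apply/setP => e; rewrite !inE; apply/andP/imsetP.
    by case=> /parent_edgesP [y yr ->] xe; exists y; rewrite // inE yr.
  by case=> y; rewrite inE => /andP [yr xe] ->; split=> //; apply/parent_edgesP; exists y.
rewrite card_in_imset; last first.
  by move=> y y'; rewrite !inE => /andP [yr _] /andP [y'r _]; apply: (parent_edge_inj rf); rewrite inE.
rewrite /parent_deg; have [->|xr] := eqVneq x r.
  rewrite addn0; apply: eq_card => y; rewrite !inE (eq_sym r (f y)).
  by case: (eqVneq y r) => //= yr; rewrite eq_sym (negPf yr).
have -> : [set y | (y != r) && (x \in [set y; f y])] = x |: [set y | (y != r) && (f y == x)].
  apply/setP => y; rewrite !inE (eq_sym x (f y)).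
  by have [->|yx] := eqVneq y x; rewrite ?xr.
by rewrite cardsU1 !inE xr (negPf (rooted_neq rf xr)) addnC.
Qed.

Lemma fconnect_step x y : fconnect f x y = (x == y) || fconnect f (f x) y.
Proof.
apply/idP/orP => [/iter_findex <-|[/eqP ->|]]; last 2 first.
- exact: connect0.
- exact: connect_trans (fconnect1 f x).
case: (findex f x y) => [|k]; first by left.
by right; rewrite iterSr; exact: fconnect_iter.
Qed.

Let cut y := parent_edges r f :\ [set y; f y].

Lemma adj_cut y u : u != r -> u != y -> y != r -> adj (cut y) u (f u).
Proof.
move=> ur uy yr; rewrite /adj /= !inE; apply/andP; split; last exact: (parent_edges_adj f).
by apply: contra_neq uy; apply: (parent_edge_inj rf); rewrite inE.
Qed.

Lemma connect_cut_descendant y x : y != r -> connect (adj (cut y)) y x = fconnect f x y.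
Proof.
move=> yr; apply/idP/idP => [yx|].
  apply: (@connect_preserves _ (adj (cut y)) (fun x => fconnect f x y) y x _ _ yx) => /= [|u v uy]; first exact: connect0.
  rewrite /adj /= !inE => /andP [ne /adj_parent_edges [[ur vE]|[vr uE]]]; last first.
    by rewrite fconnect_step -uE uy orbT.
  move: uy; rewrite vE fconnect_step => /orP [/eqP uy|//].
  by rewrite vE uy eqxx in ne.
move=> /iter_findex; move: (findex f x y) => k; elim: k x => [|k IH] x /=; first by move=> <-; exact: connect0.
have [->|xy] := eqVneq x y; first by rewrite connect0.
rewrite -[f _]/(iter k.+1 f x) iterSr => /IH yfx.
have [xr|xr] := eqVneq x r; first by move: yfx; rewrite xr (rooted_root rf).
by apply: connect_trans yfx _; rewrite connect_adjC; apply: connect1; exact: adj_cut.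
Qed.

Lemma connect_cut_parent y x : y != r -> connect (adj (cut y)) (f y) x = ~~ fconnect f x y.
Proof.
move=> yr; apply/idP/idP => [yx|nxy].
  apply: contra (bridge (parent_edges_tree rf) (parent_edges_adj f yr)) => xy.
  rewrite -/(cut y); rewrite connect_adjC in yx.
  by apply: connect_trans _ yx; rewrite connect_cut_descendant.
have := connect_delete y (f y) x (parent_edges_connected rf).
by rewrite -/(cut y) connect_cut_descendant // (negPf nxy).
Qed.

End ParentTrees.

Section Cherry.
Variables (T : finType) (r : T) (f : T -> T) (l : T).
Hypothesis rf : rooted r f.

Definition cherry (y : option (option T)) : option (option T) :=
  if y is Some (Some x) then Some (Some (f x)) else Some (Some l).

Lemma cherry_rooted : rooted (Some (Some r)) cherry.
Proof.
have [h hf] := rooted_height rf.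
pose h' y := if y is Some (Some x) then h x else (h l).+1.
apply: (@height_rooted _ _ _ h'); first by rewrite /= (rooted_root rf).
by case=> [[x|]|] //= xr; apply: hf.
Qed.

Lemma fconnect_cherry x y : fconnect cherry (Some (Some x)) (Some (Some y)) = fconnect f x y.
Proof.
have it k : iter k cherry (Some (Some x)) = Some (Some (iter k f x)).
  by elim: k => //= k ->.
apply/idP/idP => /iter_findex; last first.
  by move=> <-; rewrite -it; exact: fconnect_iter.
by rewrite it => -[<-]; exact: fconnect_iter.
Qed.

Lemma fconnect_cherry_new x : fconnect cherry (Some (Some x)) None = false /\
  fconnect cherry (Some (Some x)) (Some None) = false.
Proof.
have it k : iter k cherry (Some (Some x)) = Some (Some (iter k f x)).
  by elim: k => //= k ->.
by split; apply/negP => /iter_findex; rewrite it.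
Qed.

Lemma parent_deg_cherry x :
  parent_deg (Some (Some r)) cherry (Some (Some x)) = (parent_deg r f x + 2 * (x == l))%N.
Proof.
rewrite /parent_deg addnAC; congr (_ + _)%N.
pose SS (y : T) := Some (Some y).
have SSinj : injective SS by move=> y y' [].
have -> : [set y | (y != Some (Some r)) && (cherry y == Some (Some x))] =
  (SS @: [set y | (y != r) && (f y == x)]) :|: (if x == l then [set None; Some None] else set0).
  apply/setP => -[[y|]|]; rewrite !inE.
  - rewrite -[Some (Some y)]/(SS y) (mem_imset _ _ SSinj) !inE /=.
    by case: ifP; rewrite !inE ?orbF.
  - have /negPf -> : Some None \notin SS @: [set y | (y != r) && (f y == x)].
      by apply/imsetP => -[].
    by rewrite -[LHS]/(l == x) eq_sym; case: ifP; rewrite !inE.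
  - have /negPf -> : None \notin SS @: [set y | (y != r) && (f y == x)].
      by apply/imsetP => -[].
    by rewrite -[LHS]/(l == x) eq_sym; case: ifP; rewrite !inE.
rewrite cardsU card_imset //.
have -> : (SS @: [set y | (y != r) && (f y == x)]) :&: (if x == l then [set None; Some None] else set0) = set0.
  apply/setP => y; rewrite !inE; apply/negP => /andP [/imsetP [y' _ ->]].
  by case: ifP; rewrite !inE.
by rewrite cards0 subn0; case: ifP; rewrite ?cards2 ?cards0.
Qed.

Lemma parent_deg_cherry_new y : (forall x, y != Some (Some x)) ->
  parent_deg (Some (Some r)) cherry y = 1%N.
Proof.
move=> ny; rewrite /parent_deg ny.
suff -> : [set z | (z != Some (Some r)) && (cherry z == y)] = set0 by rewrite cards0.
apply/setP => z; rewrite !inE; apply/negP => /andP [_ /eqP zy].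
by case: z zy => [[z|]|] /= zy; [have := ny (f z)|have := ny l|have := ny l]; rewrite -zy eqxx.
Qed.

End Cherry.

(** * Building the decomposition tree *)

Section BuildTree.
Variables (R : realType) (V : finType) (N : V -> V -> R).
Hypotheses (Nsym : forall i j, N i j = N j i) (Ngt0 : forall i j, 0 < N i j).
Implicit Types (U S : {set V}) (i j k v : V).

Definition below (T : finType) (f : T -> T) (leaf : V -> T) U (y : T) : {set V} :=
  [set v in U | fconnect f (leaf v) y].

Definition decomposition U : Prop :=
  exists (T : finType) (r : T) (f : T -> T) (leaf : V -> T),
    [/\ rooted r f, {in U &, injective leaf},
        forall x, parent_deg r f x = 1%N <-> exists2 v, v \in U & x = leaf v,
        forall x, parent_deg r f x <> 1%N -> parent_deg r f x = 3%N &
        forall y, y != r -> rank_one N (below f leaf U y) (U :\: below f leaf U y)].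

Lemma rank_one1 i (B : {set V}) : rank_one N [set i] B.
Proof. by move=> a a' k k' /set1P -> /set1P -> _ _; exact: mulrC. Qed.

Lemma decomposition_pair a b : a != b -> decomposition [set a; b].
Proof.
move=> ab; exists bool, true, (fun _ => true), (fun v => v == a).
have rf : rooted true (fun _ => true) by apply: (@height_rooted _ _ _ negb) => // -[].
have ba : (b == a) = false by rewrite eq_sym (negPf ab).
have dT : parent_deg true (fun _ => true) true = 1%N.
  rewrite /parent_deg addn0 -(cards1 false); apply: eq_card => -[]; by rewrite !inE.
have dF : parent_deg true (fun _ => true) false = 1%N.
  rewrite /parent_deg -[1%N]/(0 + 1)%N; congr (_ + _)%N; rewrite -(cards0 bool).
  by apply: eq_card => -[]; rewrite !inE.
split=> //.
- by move=> u v /set2P [] -> /set2P [] ->; rewrite ?eqxx ?ba.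
- by case; split=> // _; [exists a; rewrite ?set21 ?eqxx|exists b; rewrite ?set22 ?ba].
- by case.
- case=> // _.
  have -> : below (fun _ => true) (fun v => v == a) [set a; b] false = [set b].
    apply/setP => v; rewrite !inE.
    have fc u : fconnect (fun _ => true) u false = (u == false).
      rewrite fconnect_step; case: u => //=; apply/negP => /iter_findex.
      by elim: (findex _ _ _) => [|k IH].
    by rewrite fc; case: (eqVneq v a) => [->|_] /=; rewrite ?andbF ?andbT // (negPf ab).
  exact: rank_one1.
Qed.

Lemma rank_one_twin U i j S : i \in U -> j \in U -> i != j -> twins N U i j ->
  S \subset U :\ i -> rank_one N S ((U :\ i) :\: S) ->
  rank_one N (if j \in S then i |: S else S) (U :\: (if j \in S then i |: S else S)).
Proof.
move=> iU jU ij tw /subsetP SU ro.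
have iS : i \notin S by apply/negP => /SU; rewrite !inE eqxx.
have [c ci] : exists c, forall k, k \in U :\: [set i; j] -> N i k = c * N j k.
  have [e|[k0 k0U]] := set_0Vmem (U :\: [set i; j]); first by exists 1 => k; rewrite e inE.
  exists (N i k0 / N j k0) => k kU.
  by rewrite mulrAC (tw k0 k k0U kU) mulfK // gt_eqF.
pose phi v := if v == i then j else v.
pose gam v := if v == i then c else 1.
set S' := if _ then _ else _.
have S'U v : v \in S' -> phi v \in S.
  rewrite /S' /phi; case: ifP => [jS|_ vS]; last by case: eqVneq vS iS => [-> ->|].
  by rewrite in_setU1; case: eqVneq.
have nS' v : v \in U :\: S' -> phi v \in (U :\ i) :\: S.
  rewrite /phi; case: eqVneq => [->|vi]; rewrite /S'; case: ifP => jS.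
  - by rewrite !inE eqxx.
  - by rewrite !inE jS jU eq_sym ij.
  - by rewrite !inE negb_or vi.
  - by rewrite !inE vi.
have NE a k : a \in S' -> k \in U :\: S' -> N a k = gam a * gam k * N (phi a) (phi k).
  move=> aS kS; have aS' := S'U a aS; have kS' := nS' k kS; move: aS' kS'.
  rewrite /phi /gam; have [ai|ai] := eqVneq a i; have [ki|ki] := eqVneq k i.
  - by rewrite !inE => ->.
  - move=> jS; rewrite !inE => /and3P [kS' _ kU].
    rewrite ai ci ?mulr1 // !inE negb_or ki kU andbT /=.
    by apply: contraNneq kS' => ->.
  - move=> aS'; rewrite !inE => /and3P [jS _ _].
    rewrite ki mul1r (Nsym a) (Nsym a) ci // !inE negb_or ai.
    have /SU : a \in S by []. rewrite !inE => /andP [_ ->]; rewrite andbT /=.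
    by apply: contraNneq jS => <-.
  - by rewrite !mul1r.
move=> a a' k k' aS a'S kS k'S.
rewrite (NE a k) // (NE a' k') // (NE a k') // (NE a' k) //; have := ro (phi a) (phi a') (phi k) (phi k') (S'U _ aS) (S'U _ a'S) (nS' _ kS) (nS' _ k'S).
move: (N (phi a) (phi k)) (N (phi a') (phi k')) (N (phi a) (phi k')) (N (phi a') (phi k)).
move=> n1 n2 n3 n4 e.
transitivity (gam a * gam k * gam a' * gam k' * (n1 * n2)); first by ring.
by rewrite e; ring.
Qed.

Lemma decomposition_twins U i j : i \in U -> j \in U -> i != j -> twins N U i j ->
  decomposition (U :\ i) -> decomposition U.
Proof.
move=> iU jU ij tw [T [r [f [leaf [rf linj degP deg3 cuts]]]]].
have jU' : j \in U :\ i by rewrite !inE eq_sym ij.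
pose leaf' v : option (option T) :=
  if v == i then None else if v == j then Some None else Some (Some (leaf v)).
exists (option (option T)), (Some (Some r)), (cherry f (leaf j)), leaf'.
have U'P v : v \in U -> v != i -> v \in U :\ i by rewrite !inE => -> ->.
have leafI : leaf' i = None by rewrite /leaf' eqxx.
have leafJ : leaf' j = Some None by rewrite /leaf' eqxx eq_sym (negPf ij).
have leafV v : v != i -> v != j -> leaf' v = Some (Some (leaf v)).
  by rewrite /leaf' => /negPf -> /negPf ->.
have degl : parent_deg r f (leaf j) = 1%N by apply/degP; exists j.
split.
- exact: cherry_rooted.
- move=> u v uU vU; rewrite /leaf'.
  case: (eqVneq u i) => [->|ui]; case: (eqVneq v i) => [->|vi] //; try by case: ifP.
  case: (eqVneq u j) => [->|uj]; case: (eqVneq v j) => [->|vj] // [e].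
  by apply: linj e; rewrite U'P.
- case=> [[x|]|].
  + rewrite parent_deg_cherry; split.
      case: eqVneq => [->|xl]; first by rewrite degl.
      rewrite muln0 addn0 => /degP [v]; rewrite !inE => /andP [vi vU] xv.
      exists v => //; rewrite leafV // ?xv //.
      by apply: contraNneq xl => <-; rewrite xv.
    case=> v vU; rewrite /leaf'; case: (eqVneq v i) => // vi; case: (eqVneq v j) => // vj [->].
    have -> : (leaf v == leaf j) = false.
      by apply/negP => /eqP /linj e; move: vj; rewrite e ?eqxx // U'P.
    by rewrite muln0 addn0; apply/degP; exists v; rewrite ?U'P.
  + by rewrite parent_deg_cherry_new //; split=> // _; exists j.
  + by rewrite parent_deg_cherry_new //; split=> // _; exists i.
- case=> [[x|]|]; [rewrite parent_deg_cherry|by rewrite parent_deg_cherry_new|by rewrite parent_deg_cherry_new].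
  case: eqVneq => [->|xl]; first by rewrite degl.
  by rewrite muln0 addn0; exact: deg3.
have fcI y : fconnect (cherry f (leaf j)) (leaf' i) y = (None == y) || fconnect (cherry f (leaf j)) (Some (Some (leaf j))) y.
  by rewrite leafI fconnect_step.
have fcJ y : fconnect (cherry f (leaf j)) (leaf' j) y = (Some None == y) || fconnect (cherry f (leaf j)) (Some (Some (leaf j))) y.
  by rewrite leafJ fconnect_step.
have new x := fconnect_cherry_new f (leaf j) x.
case=> [[y|]|] yr.
- have -> : below (cherry f (leaf j)) leaf' U (Some (Some y)) =
      if j \in below f leaf (U :\ i) y then i |: below f leaf (U :\ i) y else below f leaf (U :\ i) y.
    have jE : (j \in below f leaf (U :\ i) y) = fconnect f (leaf j) y by rewrite inE jU'.
    rewrite jE; apply/setP => v; rewrite inE.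
    have [->|vi] := eqVneq v i.
      rewrite iU fcI fconnect_cherry /=.
      by case: ifP => _; rewrite !inE eqxx.
    have vE : (v \in U) && fconnect (cherry f (leaf j)) (leaf' v) (Some (Some y)) =
              (v \in below f leaf (U :\ i) y).
      rewrite !inE vi; congr (_ && _); have [->|vj] := eqVneq v j.
        by rewrite fcJ fconnect_cherry.
      by rewrite leafV // fconnect_cherry.
    by rewrite vE; case: ifP => _; rewrite ?in_setU1 ?(negPf vi).
  apply: rank_one_twin => //; last by apply: cuts; apply: contra_neq yr => ->.
  by apply/subsetP => v; rewrite inE => /andP [].
- have -> : below (cherry f (leaf j)) leaf' U (Some None) = [set j].
    apply/setP => v; rewrite !inE; have [->|vj] := eqVneq v j.
      by rewrite jU fcJ eqxx.
    have [->|vi] := eqVneq v i; first by rewrite fcI (new _).2 andbF.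
    by rewrite leafV // (new _).2 andbF.
  exact: rank_one1.
- have -> : below (cherry f (leaf j)) leaf' U None = [set i].
    apply/setP => v; rewrite !inE; have [->|vi] := eqVneq v i.
      by rewrite iU fcI eqxx.
    have [->|vj] := eqVneq v j; first by rewrite fcJ (new _).1 andbF.
    by rewrite leafV // (new _).1 andbF.
  exact: rank_one1.
Qed.

Hypothesis fourpt : forall i1 i2 i3 i4, uniq [:: i1; i2; i3; i4] ->
  [|| N i1 i2 * N i3 i4 == N i1 i3 * N i2 i4, N i1 i3 * N i2 i4 == N i1 i4 * N i2 i3 |
      N i1 i4 * N i2 i3 == N i1 i2 * N i3 i4].

Lemma exists_decomposition U : (1 < #|U|)%N -> decomposition U.
Proof.
have [n] := ubnP #|U|; elim: n U => // n IH U Un U2.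
have [U3|U3] := leqP #|U| 2.
  have /cards2P [a [b [ab ->]]] : #|U| == 2%N by rewrite eqn_leq U2 U3.
  exact: decomposition_pair.
have /card_gt0P [q qU] : (0 < #|U|)%N by lia.
have [i [j [iU jU ij _ tw]]] := exists_twins Nsym Ngt0 fourpt U3 qU.
apply: (decomposition_twins iU jU ij tw); have := cardsD1 i U; rewrite iU => c.
by apply: IH; lia.
Qed.

End BuildTree.

Section Width.
Variables (R : realType) (V : finType) (E : {set {set V}}) (w : {set V} -> R).
Hypotheses (hV : (1 < #|V|)%N) (sE : simple_graph E) (cE : connected_graph E).
Hypothesis w0 : forall e, e \in E -> 0 < w e.

Lemma tree_width_gt0 (T : leaf_tree V) : (0 < tree_width E w T)%N.
Proof.
have /card_gt0P [v _] : (0 < #|V|)%N by exact: ltnW.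
have [b eF _] := leaf_edge T v; set e := [set _; _] in eF.
apply: leq_trans (leq_bigmax_cond (F := fun e => edge_width E w e) e eF).
have ve : leaf T v \in e by exact: set21.
apply: leq_trans (leq_bigmax_cond (F := fun a => cut_rank E w (side e a)) _ ve).
rewrite side_leaf // lt0n mxrank_eq0.
have : (0 < deg E v)%N by exact: connected_deg_gt0.
case/card_gt0P => e'; rewrite inE => /andP [e'E ve'].
have /eqP/cards2P [x [y [xy e'xy]]] := sE e'E.
have [u uv e'uv] : exists2 u, u != v & e' = [set u; v].
  by move: ve'; rewrite e'xy => /set2P [] ->; [exists y; rewrite 1?setUC // eq_sym|exists x].
have uA : u \in ~: [set v] by rewrite !inE.
apply/eqP => /matrixP /(_ (enum_rank_in uA u) (enum_rank_in (set11 v) v)).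
rewrite !mxE /= !enum_rankK !enum_rankK_in ?set11 // -e'uv e'E => /eqP.
by rewrite gt_eqF ?w0.
Qed.

Lemma rigid_width_one : rigid (wadj E w) setT -> exists T : leaf_tree V, (tree_width E w T <= 1)%N.
Proof.
move=> rig.
have Wsym := wadjC E w; have Wge0 i j : 0 <= wadj E w i j by exact: wadj_ge0.
have Wconn : wconnected (wadj E w) setT by exact: connected_wconnected.
pose N := resolvent (wadj E w).
have Nsym : forall i j, N i j = N j i by exact: resolventC.
have Ngt0 : forall i j, 0 < N i j by exact: resolvent_gt0.
have Nrig : rigid N setT by exact: rigid_resolvent.
have four i1 i2 i3 i4 (un : uniq [:: i1; i2; i3; i4]) :=
  four_point Nsym Ngt0 un (rigid_subset Nsym Ngt0 Nrig).
have VT : (1 < #|[set: V]|)%N by rewrite cardsT.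
have [T [r [f [leaf [rf linj degP deg3 cuts]]]]] := exists_decomposition Nsym Ngt0 four VT.
have linj' : injective leaf by move=> u v; apply: linj.
have degP' x : deg (parent_edges r f) x = 1%N <-> exists v, x = leaf v.
  by rewrite deg_parent_edges // degP; split=> [[v _ ->]|[v ->]]; exists v.
have deg3' x : deg (parent_edges r f) x <> 1%N -> deg (parent_edges r f) x = 3%N.
  by rewrite deg_parent_edges //; exact: deg3.
exists (LeafTree (parent_edges_tree rf) linj' degP' deg3').
apply/bigmax_leqP => /= e /parent_edgesP [y yr ->].
apply/bigmax_leqP => a /set2P ay; apply/cut_rank_le1P.
pose S := below f leaf setT y.
have ro : rank_one (wadj E w) S (~: S).
  by apply: rank_one_resolvent => //; rewrite -setTD; exact: cuts.
have [->|->] : @side V (LeafTree (parent_edges_tree rf) linj' degP' deg3') [set y; f y] a = S \/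
               @side V (LeafTree (parent_edges_tree rf) linj' degP' deg3') [set y; f y] a = ~: S.
  by case: ay => ->; [left|right]; apply/setP => v;
     rewrite !inE /= ?(connect_cut_descendant rf) ?(connect_cut_parent rf).
- exact: rank_oneC.
- by rewrite setCK.
Qed.

End Width.

Theorem theorem3 (R : realType) (V : finType) (E : {set {set V}})
    (w : {set V} -> R)
    (hV : (1 < #|V|)%N)
    (hsimple : simple_graph E)
    (hconn : connected_graph E)
    (hw : forall e, e \in E -> 0 < w e) :
  weighted_stable E w <-> has_width E w 1%N.
Proof.
rewrite weighted_stable_rigid //; split=> [rig|[[T wT] _]]; last first.
  by apply: (width_one_rigid (T := T)); rewrite ?wT.
split=> [|T]; last exact: tree_width_gt0.
have [T wT] := rigid_width_one hV hconn hw rig.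
by exists T; apply/eqP; rewrite eqn_leq wT tree_width_gt0.
Qed.
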